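(* Let $z^*$ be a local optimal solution of the mathematical program with switching constraints (MPSC) $$\min f(z)\quad\text{s.t.}\quad g(z)\le 0,\ h(z)=0,\ G_i(z)H_i(z)=0,\ i=1,\dots,m.$$ If either MPSC directional quasi-normality or MPSC piecewise CRSC holds at $z^*$, then $z^*$ is a local optimal solution of the (unconstrained) penalized problem $$\min_z\ f(z)+L_f\,\alpha\left[\sum_{i=1}^p\max\{0,g_i(z)\}+\sum_{j=1}^q|h_j(z)|+\sum_{i=1}^m\min\{|G_i(z)|,|H_i(z)|\}\right],$$ where $L_f$ is the Lipschitz constant of $f$ around $z^*$ and $\alpha$ is the error bound constant, i.e. $\alpha>0$ is a constant (such a constant exists under either hypothesis) for which there is a neighborhood $V(z^* )$ of $z^*$ with $$\operatorname{dist}_{\mathcal F}(z)\le\alpha\left(\sum_{i=1}^p\max\{g_i(z),0\}+\sum_{j=1}^q|h_j(z)|+\sum_{i=1}^m\min\{|G_i(z)|,|H_i(z)|\}\right)\quad\forall z\in V(z^* ).$$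
   Context: Setting: $f:\mathbb R^n\to\mathbb R$, $g:\mathbb R^n\to\mathbb R^p$, $h:\mathbb R^n\to\mathbb R^q$, $G=(G_1,\dots,G_m)$, $H=(H_1,\dots,H_m):\mathbb R^n\to\mathbb R^m$ are continuously differentiable; gradients of scalar functions are column vectors and $\nabla$ of a vector-valued map is its Jacobian. $\mathcal F$ is the feasible region of MPSC. $\operatorname{dist}_{\mathcal F}(z)$ is the distance from $z$ to $\mathcal F$ and $L_f$ is a Lipschitz constant of $f$ on a neighborhood of $z^*$, both with respect to the same (arbitrary) norm on $\mathbb R^n$. Index sets at $z^*\in\mathcal F$: $\mathcal I_g^*=\{i: g_i(z^* )=0\}$; $\mathcal I_G^*=\{i: G_i(z^* )=0,H_i(z^* )\ne0\}$; $\mathcal I_H^*=\{i: G_i(z^* )\neq0,H_i(z^* )=0\}$; $\mathcal I_{GH}^*=\{i: G_i(z^* )=H_i(z^* )=0\}$. Linearization cone $L_{\mathcal F}^{\rm lin}(z^* )$: all $d\in\mathbb R^n$ with $\nabla g_i(z^* )^Td\le0$ ($i\in\mathcal I_g^*$), $\nabla h_j(z^* )^Td=0$ ($j=1,\dots,q$), $\nabla G_i(z^* )^Td=0$ ($i\in\mathcal I_G^*$), $\nabla H_i(z^* )^Td=0$ ($i\in\mathcal I_H^*$), $(\nabla G_i(z^* )^Td)(\nabla H_i(z^* )^Td)=0$ ($i\in\mathcal I_{GH}^*$). For $d\in L_{\mathcal F}^{\rm lin}(z^* )$: $\mathcal I_g^*(d)=\{i\in\mathcal I_g^*:\nabla g_i(z^*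 )^Td=0\}$; $\mathcal I_G^*(d)=\{i\in\mathcal I_{GH}^*:\nabla G_i(z^* )^Td=0,\nabla H_i(z^* )^Td\ne0\}$; $\mathcal I_H^*(d)=\{i\in\mathcal I_{GH}^*:\nabla G_i(z^* )^Td\ne0,\nabla H_i(z^* )^Td=0\}$; $\mathcal I_{GH}^*(d)=\{i\in\mathcal I_{GH}^*:\nabla G_i(z^* )^Td=\nabla H_i(z^* )^Td=0\}$. MPSC quasi-normality in direction $d\in L_{\mathcal F}^{\rm lin}(z^* )$ holds at $z^*$ if there is no $(\lambda^g,\lambda^h,\lambda^G,\lambda^H)\ne0$ such that: (i) $0=\nabla g(z^* )^T\lambda^g+\nabla h(z^* )^T\lambda^h+\nabla G(z^* )^T\lambda^G+\nabla H(z^* )^T\lambda^H$; (ii) $\lambda_i^g\ge0$ for $i\in\mathcal I_g^*(d)$, $\lambda_i^g=0$ for $i\notin\mathcal I_g^*(d)$, $\lambda_i^H=0$ for $i\in\mathcal I_G^*\cup\mathcal I_G^*(d)$, $\lambda_i^G=0$ for $i\in\mathcal I_H^*\cup\mathcal I_H^*(d)$, $\lambda_i^G\lambda_i^H=0$ for $i\in\mathcal I_{GH}^*(d)$; (iii) there are sequences $d^k\to d$ and $t_k\downarrow0$ such that for all $k$: $\lambda_i^gg_i(z^*+t_kd^k)>0$ if $\lambda_i^g\ne0$, $\lambda_i^hh_i(z^*+t_kd^k)>0$ if $\lambda_i^h\ne0$, $\lambda_i^GG_i(z^*+t_kd^k)>0$ if $\lambda_i^G\neq0$, $\lambda_i^HH_i(z^*+t_kd^k)>0$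 if $\lambda_i^H\ne0$. MPSC directional quasi-normality holds at $z^*$ if MPSC quasi-normality holds at $z^*$ in all directions $d\in L_{\mathcal F}^{\rm lin}(z^* )$. Piecewise CRSC: $\mathcal P(\mathcal I_{GH}^* )$ is the set of all pairs $(\beta_1,\beta_2)$ of disjoint (possibly empty) sets with $\beta_1\cup\beta_2=\mathcal I_{GH}^*$. For such a pair, $\mathrm{NLP}(\beta_1,\beta_2)$ is the nonlinear program $$\min f(z)\ \text{ s.t. }\ g(z)\le0,\ h(z)=0,\ G_i(z)=0\ (i\in\mathcal I_G^*\cup\beta_1),\ H_i(z)=0\ (i\in\mathcal I_H^*\cup\beta_2).$$ For a nonlinear program with constraints $\tilde g_i(z)\le0$ ($i=1,\dots,\tilde p$), $\tilde h_j(z)=0$ ($j=1,\dots,\tilde q$) and a feasible point $\bar z$ with active set $\bar{\mathcal I}=\{i:\tilde g_i(\bar z)=0\}$, let $$\mathcal I^-=\Big\{l\in\bar{\mathcal I}: -\nabla\tilde g_l(\bar z)=\sum_{j=1}^{\tilde q}\lambda_j\nabla\tilde h_j(\bar z)+\sum_{i\in\bar{\mathcal I}\setminus\{l\}}\mu_i\nabla\tilde g_i(\bar z)\ \text{for some }\lambda_j\in\mathbb R,\ \mu_i\ge0\Big\};$$ CRSC (constant rank of subspace component) holds at $\bar z$ if there is a neighborhood of $\bar z$ on which the rank of $\{\nabla\tilde g_i(z)\}_{i\in\mathcal I^-}\cup\{\nabla\tilde h_j(z)\}_{j=1}^{\tilde q}$ is constant. MPSC piecewise CRSC holds at $z^*$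 if CRSC holds for $\mathrm{NLP}(\beta_1,\beta_2)$ at $z^*$ for every $(\beta_1,\beta_2)\in\mathcal P(\mathcal I_{GH}^* )$. *)

(* Defs.v *)
From mathcomp Require Import all_boot all_order all_algebra.
From mathcomp Require Import all_classical all_reals all_analysis.
Set Implicit Arguments.
Unset Strict Implicit.
Unset Printing Implicit Defensive.
Import Order.TTheory GRing.Theory Num.Theory.
Import numFieldNormedType.Exports.
Local Open Scope classical_set_scope.
Local Open Scope ring_scope.

(* Points of R^n are row vectors. For F : 'rV_n -> 'rV_m, the library's
   'J F z : 'M_(n, m) acts on row vectors from the right; it is the transpose of
   the textbook Jacobian, so its i-th column is the gradient of F_i at z.
   Multipliers are column vectors: 'J F z *m l is the combination of the
   gradients of the F_i with coefficients l_i. *)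
Section Calculus.
Variables (R : realType) (n : nat).

Definition grad m (F : 'rV[R]_n -> 'rV[R]_m) (i : 'I_m) (z : 'rV[R]_n) :
  'cV[R]_n := col i ('J F z).

Definition slope m (F : 'rV[R]_n -> 'rV[R]_m) (i : 'I_m) (z d : 'rV[R]_n) : R :=
  (d *m grad F i z) 0 0.

(* In finite dimension, pointwise continuity of z |-> 'd F z v for every v is
   continuity of the derivative for the operator norm. *)
Definition continuously_differentiable (W : normedModType R)
    (F : 'rV[R]_n -> W) : Prop :=
  (forall z, differentiable F z) /\
  (forall v, continuous (fun z => 'd F z v)).

Definition local_minimizer (f : 'rV[R]_n -> R) (A : set 'rV[R]_n)
    (z : 'rV[R]_n) : Prop :=
  A z /\ \forall y \near z, A y -> f z <= f y.

(* The library topology on 'rV_n is that of the sup norm; N is an arbitrary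
   other norm, used only for distances and Lipschitz constants. *)
Record is_norm (N : 'rV[R]_n -> R) : Prop := IsNorm {
  norm_triangle : forall x y, N (x + y) <= N x + N y;
  norm_scale : forall (a : R) x, N (a *: x) = `|a| * N x;
  norm_eq0 : forall x, N x = 0 -> x = 0 }.

Definition dist (N : 'rV[R]_n -> R) (A : set 'rV[R]_n) (z : 'rV[R]_n) : R :=
  inf [set N (z - y) | y in A].

Definition lipschitz_around (N : 'rV[R]_n -> R) (f : 'rV[R]_n -> R)
    (z : 'rV[R]_n) (L : R) : Prop :=
  exists2 U, nbhs z U &
    forall x y, U x -> U y -> `|f x - f y| <= L * N (x - y).

End Calculus.

Section NLP.
Variables (R : realType) (n : nat).

Record nlp (p q : nat) := NLP {
  nlp_f : 'rV[R]_n -> R;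
  nlp_g : 'rV[R]_n -> 'rV[R]_p;
  nlp_h : 'rV[R]_n -> 'rV[R]_q }.

Variables (p q : nat) (P : nlp p q).
Local Notation g := (nlp_g P).
Local Notation h := (nlp_h P).

Definition nlp_active (z : 'rV[R]_n) : {set 'I_p} :=
  [set i | g z 0 i == 0]%SET.

Definition nlp_Iminus (z : 'rV[R]_n) : {set 'I_p} :=
  [set l in nlp_active z |
    `[< exists (lam : 'I_q -> R) (mu : 'I_p -> R), (forall i, 0 <= mu i) /\
          - grad g l z = \sum_j lam j *: grad h j z
             + \sum_(i in (nlp_active z :\ l)%SET) mu i *: grad g i z >]]%SET.

(* rank of the family of the gradients of g_i, i in I, and of all h_j, at z *)
Definition nlp_grad_rank (I : {set 'I_p}) (z : 'rV[R]_n) : nat :=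
  \rank (row_mx (\matrix_(k < n, i < #|I|) grad g (enum_val i) z k 0)
                ('J h z)).

Definition CRSC (z : 'rV[R]_n) : Prop :=
  \forall y \near z,
    nlp_grad_rank (nlp_Iminus z) y = nlp_grad_rank (nlp_Iminus z) z.

End NLP.

Section MPSC.
Variables (R : realType) (n : nat).

Record mpsc (p q m : nat) := MPSC {
  mpsc_f : 'rV[R]_n -> R;
  mpsc_g : 'rV[R]_n -> 'rV[R]_p;
  mpsc_h : 'rV[R]_n -> 'rV[R]_q;
  mpsc_G : 'rV[R]_n -> 'rV[R]_m;
  mpsc_H : 'rV[R]_n -> 'rV[R]_m }.

Variables (p q m : nat) (P : mpsc p q m).
Local Notation f := (mpsc_f P).
Local Notation g := (mpsc_g P).
Local Notation h := (mpsc_h P).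
Local Notation G := (mpsc_G P).
Local Notation H := (mpsc_H P).

Definition mpsc_C1 : Prop :=
  [/\ continuously_differentiable f, continuously_differentiable g,
      continuously_differentiable h, continuously_differentiable G
    & continuously_differentiable H].

Definition feasible : set 'rV[R]_n :=
  [set z | [/\ forall i, g z 0 i <= 0, forall j, h z 0 j = 0
             & forall i, G z 0 i * H z 0 i = 0]].

Definition residual (z : 'rV[R]_n) : R :=
  \sum_(i < p) Num.max 0 (g z 0 i) + \sum_(j < q) `|h z 0 j|
  + \sum_(i < m) Num.min `|G z 0 i| `|H z 0 i|.

Definition error_bound (N : 'rV[R]_n -> R) (zs : 'rV[R]_n) (alpha : R) : Prop :=
  0 < alpha /\ \forall z \near zs, dist N feasible z <= alpha * residual z.

Section IndexSets.
Variable zs : 'rV[R]_n.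

Definition Ig : {set 'I_p} := [set i | g zs 0 i == 0]%SET.
Definition IG : {set 'I_m} := [set i | (G zs 0 i == 0) && (H zs 0 i != 0)]%SET.
Definition IH : {set 'I_m} := [set i | (G zs 0 i != 0) && (H zs 0 i == 0)]%SET.
Definition IGH : {set 'I_m} := [set i | (G zs 0 i == 0) && (H zs 0 i == 0)]%SET.

Definition lin_cone : set 'rV[R]_n := [set d |
  [/\ forall i, i \in Ig -> slope g i zs d <= 0,
      forall j, slope h j zs d = 0,
      forall i, i \in IG -> slope G i zs d = 0,
      forall i, i \in IH -> slope H i zs d = 0
    & forall i, i \in IGH -> slope G i zs d * slope H i zs d = 0]].

Variable d : 'rV[R]_n.

Definition Igd : {set 'I_p} := [set i in Ig | slope g i zs d == 0]%SET.
Definition IGd : {set 'I_m} :=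
  [set i in IGH | (slope G i zs d == 0) && (slope H i zs d != 0)]%SET.
Definition IHd : {set 'I_m} :=
  [set i in IGH | (slope G i zs d != 0) && (slope H i zs d == 0)]%SET.
Definition IGHd : {set 'I_m} :=
  [set i in IGH | (slope G i zs d == 0) && (slope H i zs d == 0)]%SET.

Definition stationary_multipliers (lg : 'cV[R]_p) (lh : 'cV[R]_q)
    (lG lH : 'cV[R]_m) : Prop :=
  0 = 'J g zs *m lg + 'J h zs *m lh + 'J G zs *m lG + 'J H zs *m lH.

Definition sign_conditions (lg : 'cV[R]_p) (lG lH : 'cV[R]_m) : Prop :=
  [/\ forall i, i \in Igd -> 0 <= lg i 0,
      forall i, i \notin Igd -> lg i 0 = 0,
      forall i, i \in (IG :|: IGd)%SET -> lH i 0 = 0,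
      forall i, i \in (IH :|: IHd)%SET -> lG i 0 = 0
    & forall i, i \in IGHd -> lG i 0 * lH i 0 = 0].

Definition sequential_conditions (lg : 'cV[R]_p) (lh : 'cV[R]_q)
    (lG lH : 'cV[R]_m) : Prop :=
  exists (dk : nat -> 'rV[R]_n) (tk : nat -> R),
    [/\ dk @ \oo --> d, (forall k, 0 < tk k), tk @ \oo --> (0 : R)
      & forall k, let zk := zs + tk k *: dk k in
        [/\ forall i, lg i 0 != 0 -> 0 < lg i 0 * g zk 0 i,
            forall j, lh j 0 != 0 -> 0 < lh j 0 * h zk 0 j,
            forall i, lG i 0 != 0 -> 0 < lG i 0 * G zk 0 i
          & forall i, lH i 0 != 0 -> 0 < lH i 0 * H zk 0 i]].

Definition quasi_normality_in_direction : Prop :=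
  ~ exists (lg : 'cV[R]_p) (lh : 'cV[R]_q) (lG lH : 'cV[R]_m),
      [/\ (lg, lh, lG, lH) <> 0,
          stationary_multipliers lg lh lG lH,
          sign_conditions lg lG lH
        & sequential_conditions lg lh lG lH].

End IndexSets.

Definition directional_quasi_normality (zs : 'rV[R]_n) : Prop :=
  forall d, lin_cone zs d -> quasi_normality_in_direction zs d.

(* the subvector of v with indices in A, in increasing order *)
Definition subrow (A : {set 'I_m}) (v : 'rV[R]_m) : 'rV[R]_#|A| :=
  \row_i v 0 (enum_val i).

Definition nlp_branch (zs : 'rV[R]_n) (b1 b2 : {set 'I_m}) :
    nlp R n p (q + (#|(IG zs :|: b1)%SET| + #|(IH zs :|: b2)%SET|)) :=
  NLP f g
    (fun z => row_mx (h z) (row_mx (subrow (IG zs :|: b1)%SET (G z))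
                                   (subrow (IH zs :|: b2)%SET (H z)))).

Definition piecewise_CRSC (zs : 'rV[R]_n) : Prop :=
  forall b1 b2 : {set 'I_m},
    [disjoint b1 & b2]%bool -> (b1 :|: b2)%SET = IGH zs ->
    CRSC (nlp_branch zs b1 b2) zs.

End MPSC.

(* Main.v *)
(** If no error bound holds at [zs], penalisation yields bad points: let s be
    the Euclidean residual and z a point with dist z > (2/e) residual z; a
    minimiser y of s + e |. - z| over a ball around z is infeasible, satisfies
    s y <= e |y - zs|, and is almost stationary for s.  Along the branch b of
    indices with |G_i| <= |H_i|, the function s is smooth at y, and its gradient
    combines the constraint gradients with multipliers (max(0,g), h, G_b, H_~b)/s
    that form a Euclidean unit vector with exactly the signs of the constraint
    values.  An ultrafilter on the bad points makes the branch constant and the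
    multipliers and the direction (y - zs)/|y - zs| converge as e -> 0; the limits
    violate quasi-normality in the limiting direction.

    Under CRSC for the limiting branch, let Phi collect that branch's equality
    constraints and the g_i, i in I^-.  By constant rank, any l annihilated by
    the derivative of Phi at [zs] satisfies Phi y . l = o(Phi y).  Applied to the
    relations defining I^- this gives |Phi| = O(s) along the ultrafilter; applied
    to the limit multipliers it gives Phi . l = o(s), whereas Phi . l / s tends
    to the squared norm of the unit multiplier vector, that is 1. *)

Require Import Defs.
From mathcomp Require Import all_boot all_order all_algebra.
From mathcomp Require Import all_classical all_reals all_analysis.
From mathcomp Require Import ring lra.
Set Implicit Arguments.
Unset Strict Implicit.
Unset Printing Implicit Defensive.
Import Order.TTheory GRing.Theory Num.Theory.
Import numFieldNormedType.Exports.
Local Open Scope classical_set_scope.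
Local Open Scope ring_scope.

(** * Matrix norms and neighbourhoods *)

Section MatrixNorm.
Variable R : realType.

Lemma ler_coord_norm m n (A : 'M[R]_(m, n)) i j : `|A i j| <= `|A|.
Proof.
by rewrite [leRHS]/Num.norm /= mx_normrE; apply: (le_bigmax _ _ (i, j)).
Qed.

Lemma mx_norm_leP m n (A : 'M[R]_(m, n)) (e : R) : 0 <= e ->
  (`|A| <= e) <-> (forall i j, `|A i j| <= e).
Proof.
move=> e0; split=> [Ae i j|Ae]; first exact: le_trans (ler_coord_norm _ _ _) Ae.
rewrite [leLHS]/Num.norm /= mx_normrE; apply/bigmax_leP.
by split=> // -[i j] _; exact: Ae.
Qed.

Lemma ler_mulmx_norm m n k (x : 'M[R]_(m, n)) (A : 'M[R]_(n, k)) i j :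
  `|(x *m A) i j| <= `|x| * \sum_l `|A l j|.
Proof.
rewrite mxE (le_trans (ler_norm_sum _ _ _))// mulr_sumr ler_sum// => l _.
by rewrite normrM ler_wpM2r// ler_coord_norm.
Qed.

Lemma mulmx_norm_bound m n k (A : 'M[R]_(n, k)) :
  exists2 C : R, 0 < C & forall x : 'M[R]_(m, n), `|x *m A| <= C * `|x|.
Proof.
have S0 : 0 <= \sum_j \sum_l `|A l j| by do 2 (apply: sumr_ge0 => ? _).
exists (1 + \sum_j \sum_l `|A l j|); first by lra.
move=> x; apply/mx_norm_leP => [|i j]; first by rewrite mulr_ge0//; lra.
rewrite (le_trans (ler_mulmx_norm _ _ _ _))// mulrC ler_wpM2r//.
rewrite (bigD1 j)//= in S0 *.
have : 0 <= \sum_(i < k | i != j) \sum_l `|A l i|.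
  by do 2 (apply: sumr_ge0 => ? _).
lra.
Qed.

Lemma cvg_mxP (T : Type) (F : set_system T) (FF : Filter F) m n
    (f : T -> 'M[R]_(m, n)) (A : 'M[R]_(m, n)) :
  (forall i j, f x i j @[x --> F] --> A i j) -> f @ F --> A.
Proof.
move=> fA; apply/cvgrPdist_le => e e0.
have : \forall x \near F, forall ij : 'I_m * 'I_n,
    `|A ij.1 ij.2 - f x ij.1 ij.2| <= e.
  apply: filter_forall => -[i j] /=.
  by move/cvgrPdist_le : (fA i j) => /(_ _ e0).
apply: filterS => x H; apply/mx_norm_leP; first exact: ltW.
by move=> i j; rewrite !mxE; exact: (H (i, j)).
Qed.

Lemma near_normP (V : normedModType R) (x : V) (P : set V) :
  (\forall y \near x, P y) <->
  (exists2 d : R, 0 < d & forall y, `|y - x| < d -> P y).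
Proof.
split.
  move/nbhs_ballP => [d d0 dP]; exists d => // y yx; apply: dP.
  by rewrite -ball_normE/= distrC.
move=> [d d0 dP]; apply/nbhs_ballP; exists d => // y.
by rewrite -ball_normE/= distrC => /dP.
Qed.

Lemma continuous_nearP (V W : normedModType R) (f : V -> W) (z : V) :
  {for z, continuous f} <->
  (forall e : R, 0 < e -> \forall y \near z, `|f y - f z| <= e).
Proof.
split=> [/cvgrPdist_le H e /H|H]; first by apply: filterS => y; rewrite distrC.
by apply/cvgrPdist_le => e /H; apply: filterS => y; rewrite distrC.
Qed.

Lemma continuousB_norm (V : normedModType R) (z x : V) :
  {for x, continuous (fun y : V => `|y - z|)}.
Proof.
apply: cvg_norm; apply: cvgB; [exact: cvg_id|exact: cvg_cst].
Qed.

Lemma within_continuous_norm (V W : normedModType R) (A : set V) (f : V -> W) :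
  (forall x, A x -> forall e : R, 0 < e -> exists2 d : R, 0 < d &
     forall y, A y -> `|y - x| < d -> `|f y - f x| <= e) ->
  {within A, continuous f}.
Proof.
move=> H; apply/subspace_continuousP => x Ax; apply/cvgrPdist_le => e e0.
have [d d0 Hd] := H x Ax e e0.
rewrite near_withinE; apply/near_normP; exists d => // y yx Ay.
by rewrite distrC; exact: Hd.
Qed.

Lemma near_norm_le (V : normedModType R) (z : V) (e : R) : 0 < e ->
  \forall y \near z, `|y - z| <= e.
Proof. by move=> e0; apply/near_normP; exists e => // y /ltW. Qed.

Lemma closed_ball_rV_compact n (z : 'rV[R]_n) (r : R) :
  compact [set x : 'rV[R]_n | `|x - z| <= r].
Proof.
apply: bounded_closed_compact.
  exists (r + `|z|); split; first exact: num_real.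
  move=> M rM x /= xr; rewrite (le_trans _ (ltW rM))//.
  by rewrite -[x](subrK z) (le_trans (ler_normD _ _))// lerD2r.
have cf : continuous (fun x : 'rV[R]_n => `|x - z|).
  by move=> x; apply: continuousB_norm.
apply: (@preimage_closed _ _ (fun x : 'rV[R]_n => `|x - z|)
  [set t : R | t <= r]).
  by move=> x _; exact: cf.
exact: closed_le.
Qed.

End MatrixNorm.
Arguments closed_ball_rV_compact {R n}.

(** * Gradients of scalar functions *)

Section Gradient.
Variables (R : realType) (n : nat).
Implicit Types (f : 'rV[R]_n -> R) (z v : 'rV[R]_n) (a : 'cV[R]_n).

(** Fréchet differentiability with an explicit gradient column. The remainder form permits direct
    estimates, as for the squared positive part. *)
Definition has_grad f z a := forall e : R, 0 < e ->
  \forall y \near z, `|f y - f z - ((y - z) *m a) 0 0| <= e * `|y - z|.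

Lemma ler_pairing v a : `|(v *m a) 0 0| <= `|v| * \sum_k `|a k 0|.
Proof. exact: ler_mulmx_norm. Qed.

Lemma differentiable_has_grad m (F : 'rV[R]_n -> 'rV[R]_m) z i :
  differentiable F z -> has_grad (fun y => F y 0 i) z (grad F i z).
Proof.
move=> dF e e0; have /diff_locally/eqaddoP/(_ e e0) := dF.
move=> /near_normP[d d0 H]; apply/near_normP; exists d => // y yz.
have H1 : `|F (y - z + z) - (F z + 'd F z (y - z))| <= e * `|y - z|.
  by apply: H; rewrite subr0.
rewrite subrK in H1.
apply: le_trans H1; rewrite -addrA -opprD /grad.
rewrite (_ : _ - _ = (F y - (F z + 'd F z (y - z))) 0 i) ?ler_coord_norm//.
rewrite !mxE -(mul_rV_lin1 ('d F z)) -/(jacobian F z) /= !mxE.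
by congr (_ - (_ + _)); apply: eq_bigr => k _; rewrite !mxE.
Qed.

(** Uniqueness of the differential: [mulmxr A] is continuous and satisfies the defining expansion.
    It serves to compute the Jacobian of the stacked constraints of a branch. *)
Lemma has_grad_jacobian m (F : 'rV[R]_n -> 'rV[R]_m) z (A : 'M[R]_(n, m)) :
  (forall i, has_grad (fun y => F y 0 i) z (col i A)) -> 'J F z = A.
Proof.
move=> HF; rewrite /jacobian.
suff E : 'd F z = mulmxr A :> (_ -> _).
  by apply/row_matrixP => i; rewrite !rowE mul_rV_lin1 /= E.
apply: diff_unique.
  apply: bounded_linear_continuous.
  have [C C0 HC] := mulmx_norm_bound 1 A.
  exists C; split => [|M CM]; first exact: num_real.
  apply/(@near_normP _ _ (0 : 'rV[R]_n)); exists 1 => // y.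
  rewrite subr0 => y1 /=.
  by rewrite (le_trans (HC _))// (le_trans _ (ltW CM))// ler_piMr// ltW.
apply/eqaddoP => e e0.
have : \forall y \near z, forall i,
    `|F y 0 i - F z 0 i - ((y - z) *m col i A) 0 0| <= e * `|y - z|.
  by apply: (@filter_forall _ _ _ (nbhs z) (nbhs_filter z)) => i; exact: HF.
move=> /near_normP[d d0 H]; apply/(@near_normP _ _ (0 : 'rV[R]_n)); exists d => // v.
rewrite subr0 => vd; have := H (v + z); rewrite addrK => /(_ vd) {}H.
apply/mx_norm_leP => [|j i]; first by rewrite mulr_ge0// ltW.
rewrite ord1; apply: le_trans (H i).
rewrite [X in `|X|](_ : _ = (F (v + z) - (F z + v *m A)) 0 i); last by [].
rewrite !mxE opprD addrA.
by under [in leRHS]eq_bigr do rewrite mxE.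
Qed.

Lemma has_grad_lipschitz f z a : has_grad f z a ->
  exists2 C : R, 0 < C & \forall y \near z, `|f y - f z| <= C * `|y - z|.
Proof.
move=> /(_ 1 ltr01) H.
have S0 : 0 <= \sum_k `|a k 0| by apply: sumr_ge0.
exists (1 + \sum_k `|a k 0|); first by lra.
near=> y.
have : `|f y - f z - ((y - z) *m a) 0 0| <= 1 * `|y - z| by near: y.
have := ler_pairing (y - z) a.
have := ler_normD (f y - f z - ((y - z) *m a) 0 0) (((y - z) *m a) 0 0).
rewrite subrK; lra.
Unshelve. all: by end_near. Qed.

Lemma has_grad_continuous f z a : has_grad f z a -> {for z, continuous f}.
Proof.
move=> /has_grad_lipschitz[C C0 H]; apply/continuous_nearP => e e0; near=> y.
rewrite (@le_trans _ _ (C * `|y - z|))//; first by near: y.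
rewrite -ler_pdivlMl//; near: y; apply: (@near_norm_le _ 'rV[R]_n).
by rewrite mulr_gt0// invr_gt0.
Unshelve. all: by end_near. Qed.

Lemma has_grad_near_shift f z a : has_grad f z a ->
  forall e : R, 0 < e -> \forall y \near z, `|f y - f z| < e.
Proof.
move=> /has_grad_continuous/continuous_nearP fc e e0; near=> y.
rewrite (@le_lt_trans _ _ (e / 2))//; last by lra.
by near: y; apply: fc; lra.
Unshelve. all: by end_near. Qed.

Lemma has_gradD f g z a b : has_grad f z a -> has_grad g z b ->
  has_grad (fun y => f y + g y) z (a + b).
Proof.
move=> Hf Hg e e0; near=> y.
have : `|f y - f z - ((y - z) *m a) 0 0| <= e / 2 * `|y - z|.
  by near: y; apply: Hf; lra.
have : `|g y - g z - ((y - z) *m b) 0 0| <= e / 2 * `|y - z|.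
  by near: y; apply: Hg; lra.
have := ler_normD (f y - f z - ((y - z) *m a) 0 0)
  (g y - g z - ((y - z) *m b) 0 0).
rewrite mulmxDr !mxE => H1 H2 H3.
rewrite (_ : _ - _ = (f y - f z - \sum_j (y - z) 0 j * a j 0) +
  (g y - g z - \sum_j (y - z) 0 j * b j 0)); [lra|ring].
Unshelve. all: by end_near. Qed.

Lemma has_grad_cst (c : R) z : has_grad (fun=> c) z 0.
Proof.
move=> e e0; near=> y.
by rewrite mulmx0 mxE !subrr normr0 mulr_ge0// ltW.
Unshelve. all: by end_near. Qed.

Lemma has_grad_sum (I : Type) (r : seq I) (P : pred I) (f : I -> 'rV[R]_n -> R)
    z (a : I -> 'cV[R]_n) :
  (forall i, has_grad (f i) z (a i)) ->
  has_grad (fun y => \sum_(i <- r | P i) f i y) z (\sum_(i <- r | P i) a i).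
Proof.
move=> H; elim: r => [|i r IH].
  by under eq_fun do rewrite big_nil; rewrite big_nil; exact: has_grad_cst.
under eq_fun do rewrite big_cons; rewrite big_cons.
by case: ifP => // _; exact: has_gradD.
Qed.

Lemma has_grad_comp f z a (r : R -> R) (dr : R) : has_grad f z a ->
  (forall e : R, 0 < e -> \forall t \near f z,
     `|r t - r (f z) - dr * (t - f z)| <= e * `|t - f z|) ->
  has_grad (fun y => r (f y)) z (dr *: a).
Proof.
move=> Hf Hr e e0.
have [C C0 HC] := has_grad_lipschitz Hf.
have D0 : 0 < 1 + `|dr| by have := normr_ge0 dr; lra.
(* Half of [e] goes to the remainder of [r], rescaled by the local Lipschitz constant [C] of [f];
   the other half goes to the remainder of [f], rescaled by [1 + |dr|] so that [dr = 0] is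
   covered. *)
have eC0 : 0 < e / 2 / C by rewrite divr_gt0//; lra.
have nr := has_grad_continuous Hf (Hr _ eC0).
near=> y.
have H1 : `|r (f y) - r (f z) - dr * (f y - f z)| <=
    e / 2 / C * `|f y - f z|.
  by near: y; exact: nr.
have H2 : `|f y - f z - ((y - z) *m a) 0 0| <= e / 2 / (1 + `|dr|) * `|y - z|.
  by near: y; apply: Hf; rewrite divr_gt0//; lra.
have H3 : `|f y - f z| <= C * `|y - z| by near: y.
have H4 : e / 2 / C * `|f y - f z| <= e / 2 * `|y - z|.
  rewrite -mulrA ler_wpM2l//; first lra.
  by rewrite ler_pdivrMl.
have H5 : `|dr * (f y - f z - ((y - z) *m a) 0 0)| <= e / 2 * `|y - z|.
  rewrite normrM; apply: le_trans (ler_wpM2l (normr_ge0 _) H2) _.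
  rewrite mulrA ler_wpM2r// mulrCA ler_piMr//; first lra.
  by rewrite ler_pdivrMr// mul1r; lra.
rewrite -scalemxAr mxE.
rewrite (_ : _ - _ = r (f y) - r (f z) - dr * (f y - f z) +
  dr * (f y - f z - ((y - z) *m a) 0 0)); last by ring.
by rewrite (le_trans (ler_normD _ _))//; lra.
Unshelve. all: by end_near. Qed.

Lemma has_gradZ (c : R) f z a : has_grad f z a ->
  has_grad (fun y => c * f y) z (c *: a).
Proof.
move=> /has_grad_comp; apply => e e0; near=> t.
by rewrite -mulrBr subrr normr0 mulr_ge0// ltW.
Unshelve. all: by end_near. Qed.

Lemma has_grad_linear a z : has_grad (fun y => (y *m a) 0 0) z a.
Proof.
move=> e e0; near=> y.
rewrite mulmxBl !mxE subrr normr0 mulr_ge0// ltW//.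
Unshelve. all: by end_near. Qed.

Lemma has_grad_sqr f z a : has_grad f z a ->
  has_grad (fun y => (f y) ^+ 2) z ((2 * f z) *: a).
Proof.
move=> /(@has_grad_comp _ _ _ (fun t => t ^+ 2)); apply => e e0; near=> t.
rewrite (_ : _ - _ = (t - f z) * (t - f z)); last by ring.
rewrite normrM ler_wpM2r//; near: t; exact: near_norm_le.
Unshelve. all: by end_near. Qed.

(** Squaring removes the kink of the positive part: whatever the signs of [t] and [x], the
    first-order remainder lies between 0 and [(t - x) ^+ 2]. *)
Lemma has_grad_pos_sqr f z a : has_grad f z a ->
  has_grad (fun y => (Num.max 0 (f y)) ^+ 2) z ((2 * Num.max 0 (f z)) *: a).
Proof.
move=> /(@has_grad_comp _ _ _ (fun t => (Num.max 0 t) ^+ 2)).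
apply => e e0; near=> t.
have : `|t - f z| <= e by near: t; exact: (@near_norm_le _ R^o).
move: (f z) => x tx_e.
have H : 0 <= (Num.max 0 t) ^+ 2 - (Num.max 0 x) ^+ 2 - 2 * Num.max 0 x * (t - x)
   <= `|t - x| * `|t - x|.
  rewrite -normrM -expr2 ger0_norm ?sqr_ge0//.
  rewrite !expr2; have := sqr_ge0 (t - x); rewrite expr2 => tx.
  case: (leP 0 t) => t0; case: (leP 0 x) => x0.
  - by apply/andP; split; lra.
  - by apply/andP; split; [have := mulr_ge0 t0 t0; lra|nra].
  - by apply/andP; split; nra.
  - by apply/andP; split; nra.
move/andP : H => [H1 H2]; rewrite ger0_norm//.
by apply: (le_trans H2); apply: ler_wpM2r.
Unshelve. all: by end_near. Qed.

End Gradient.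

(** * The constant rank lemma *)

Section ConstantRank.
Variable R : realType.

Lemma ler_norm_mulmx m n k (M : 'M[R]_(m, n)) (N : 'M[R]_(n, k)) :
  `|M *m N| <= n%:R * `|M| * `|N|.
Proof.
apply/mx_norm_leP => [|i j]; first by rewrite !mulr_ge0.
rewrite (le_trans (ler_mulmx_norm _ _ _ _))// (mulrC n%:R) -mulrA.
rewrite ler_wpM2l// mulr_natl.
rewrite -[X in _ *+ X]card_ord -sumr_const ler_sum// => l _.
exact: ler_coord_norm.
Qed.

(** The usual mean value theorem with derivatives in remainder form. The remainder bound is
    two-sided even at 0 and 1, so [th] has to be controlled slightly outside the unit interval. *)
Lemma mean_value01 (th dth : R -> R) :
  (forall t : R, 0 <= t <= 1 -> forall e : R, 0 < e ->
     \forall s \near t, `|th s - th t - dth t * (s - t)| <= e * `|s - t|) ->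
  exists2 c, 0 <= c <= 1 & th 1 - th 0 = dth c.
Proof.
move=> H.
have Hd (t : R) : 0 <= t <= 1 -> is_derive t 1 th (dth t).
  move=> /H {}H.
  have cv : (fun h => h^-1 *: ((th \o shift t) (h *: 1) - th t)) @ 0^' --> dth t.
    apply/cvgrPdist_le => e e0; rewrite near_withinE.
    have /near_normP[d d0 Hd] := H e e0.
    apply/(@near_normP _ R^o); exists d => // h; rewrite subr0 => hd h0.
    have := Hd (h + t); rewrite addrK => /(_ hd).
    rewrite /= /GRing.scale /= mulr1 => Hh.
    rewrite distrC -(@ler_pM2r _ `|h|) ?normr_gt0// -normrM.
    by rewrite mulrBl mulrAC mulVf// mul1r.
  by split; [apply/cvg_ex; exists (dth t)|exact: cvg_lim cv].
have [||c] := @MVT_segment R th dth 0 1 ler01.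
- move=> x; rewrite in_itv/= => /andP[x0 x1]; apply: Hd.
  by rewrite (ltW x0) (ltW x1).
- apply: derivable_within_continuous => x; rewrite in_itv/= => /Hd Hx.
  exact: ex_derive.
- by rewrite in_itv/= subr0 mulr1 => c01 ->; exists c.
Qed.

(** A minimiser [x] of [|Psi x - w|] over the closed ball exists by compactness. The corrected point
    [x + (w - Psi x)] at least halves this error, so the minimum is 0. *)
Lemma near_identity_surj n (Psi : 'rV[R]_n -> 'rV[R]_n) (xb : 'rV[R]_n) (r : R) :
  0 < r -> Psi xb = 0 ->
  (forall x y, `|x - xb| <= r -> `|y - xb| <= r ->
     `|Psi x - Psi y - (x - y)| <= 2^-1 * `|x - y|) ->
  forall w, `|w| <= r / 5 -> exists2 x, `|x - xb| <= r & Psi x = w.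
Proof.
move=> r0 Psi0 HPsi w wr.
have xb_ball : `|xb - xb| <= r by rewrite subrr normr0 ltW.
have lip x y : `|x - xb| <= r -> `|y - xb| <= r ->
    `|Psi x - Psi y| <= 2 * `|x - y|.
  move=> xr yr; have := HPsi x y xr yr.
  have := ler_normD (Psi x - Psi y - (x - y)) (x - y); rewrite subrK.
  by have := normr_ge0 (x - y); lra.
have [||x + xmin] := @EVT_min_rV R n (fun x => `|Psi x - w|)
    [set x | `|x - xb| <= r] _ (closed_ball_rV_compact xb r).
- by exists xb.
- apply: within_continuous_norm => y /= yr e e0; exists (e / 2); first lra.
  move=> z zr zy; rewrite (le_trans (ler_dist_dist _ _))//.
  rewrite opprB addrA subrK (le_trans (lip _ _ zr yr))//.
  by lra.
rewrite inE /= => xr.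
have xopt y : `|y - xb| <= r -> `|Psi x - w| <= `|Psi y - w|.
  by move=> yr; apply: xmin; rewrite inE.
exists x => //.
suff mu_eq0 : `|Psi x - w| = 0 by apply/subr0_eq; exact: normr0_eq0.
set mu := `|Psi x - w|; have mu0 : 0 <= mu by exact: normr_ge0.
have mu_w : mu <= `|w| by have := xopt xb xb_ball; rewrite Psi0 sub0r normrN.
(* The minimiser is within [4 * r / 5] of [xb] and the correction has length at most [r / 5], so the
   corrected point stays in the ball; this is the origin of the constant 5. *)
have x_w : `|x - xb| <= 4 * `|w|.
  have := HPsi x xb xr xb_ball; rewrite Psi0 subr0 distrC => H1.
  have := ler_normD (x - xb - Psi x) (Psi x); rewrite subrK => H2.
  by have := ler_normD (Psi x - w) w; rewrite subrK -/mu; lra.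
have x'r : `|x + (w - Psi x) - xb| <= r.
  rewrite addrAC (le_trans (ler_normD _ _))// [X in _ + X]distrC.
  by rewrite -/mu; lra.
have := xopt _ x'r; have := HPsi _ _ x'r xr.
rewrite (_ : x + (w - Psi x) - x = w - Psi x); last by rewrite addrAC subrr add0r.
rewrite opprB addrA subrK (distrC w) -/mu; lra.
Qed.

End ConstantRank.

Section ConstantRankVanish.
Variable R : realType.

Lemma mulmx_sum_col n k (A : 'M[R]_(n, k)) (l : 'cV[R]_k) :
  A *m l = \sum_i l i 0 *: col i A.
Proof.
apply/colP => j; rewrite mxE summxE; apply: eq_bigr => i _.
by rewrite !mxE mulrC.
Qed.

Lemma has_grad_mulmx n k (F : 'rV[R]_n -> 'rV[R]_k) z (A : 'M[R]_(n, k))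
    (l : 'cV[R]_k) :
  (forall i, has_grad (fun y => F y 0 i) z (col i A)) ->
  has_grad (fun y => (F y *m l) 0 0) z (A *m l).
Proof.
move=> HF.
have -> : (fun y => (F y *m l) 0 0) = (fun y => \sum_i l i 0 * F y 0 i).
  by apply/funext => y; rewrite mxE; apply: eq_bigr => i _; rewrite mulrC.
rewrite mulmx_sum_col.
by apply: has_grad_sum => i; exact: has_gradZ.
Qed.

Lemma mulmx_col n k (x : 'rV[R]_n) (M : 'M[R]_(n, k)) i :
  (x *m M) 0 i = (x *m col i M) 0 0.
Proof. by rewrite colE mulmxA -colE [RHS]mxE. Qed.

Lemma segment_in_ball (V : normedModType R) (x y z : V) (r t : R) :
  0 <= t <= 1 -> `|x - z| <= r -> `|y - z| <= r -> `|y + t *: (x - y) - z| <= r.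
Proof.
move=> /andP[t0 t1] xr yr.
have -> : y + t *: (x - y) - z = (1 - t) *: (y - z) + t *: (x - z).
  have -> : x - y = (x - z) - (y - z) by rewrite opprB addrA subrK.
  rewrite scalerBl scale1r scalerBr addrAC -[RHS]addrA; congr (_ + _).
  by rewrite addrC.
apply: (le_trans (ler_normD _ _)); rewrite !normrZ !ger0_norm ?subr_ge0//.
have : t * `|x - z| <= t * r by rewrite ler_wpM2l.
have : (1 - t) * `|y - z| <= (1 - t) * r by rewrite ler_wpM2l ?subr_ge0.
by lra.
Qed.

(** The scalar mean value theorem is applied to each coordinate of [F] minus the linear map [B]
    along the segment from [y] to [x]; with the sup norm nothing is lost in passing to
    coordinates. *)
Lemma near_mean_value n k (F : 'rV[R]_n -> 'rV[R]_k)
    (D : 'rV[R]_n -> 'M[R]_(n, k)) (B : 'M[R]_(n, k)) (xb : 'rV[R]_n) (r c : R) :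
  0 <= c ->
  (forall z i, has_grad (fun y => F y 0 i) z (col i (D z))) ->
  (forall z, `|z - xb| <= r ->
     forall v : 'rV[R]_n, `|v *m (D z - B)| <= c * `|v|) ->
  forall x y, `|x - xb| <= r -> `|y - xb| <= r ->
    `|F x - F y - (x - y) *m B| <= c * `|x - y|.
Proof.
move=> c0 HF HD x y xr yr.
apply/mx_norm_leP => [|i j]; first by rewrite mulr_ge0.
rewrite ord1 {i}.
pose th t : R := F (y + t *: (x - y)) 0 j - t * ((x - y) *m B) 0 j.
pose dth t : R := ((x - y) *m (D (y + t *: (x - y)) - B)) 0 j.
have [t t01 e e0|t t01] := @mean_value01 R th dth.
  have /(_ (e / (`|x - y| + 1))) := HF (y + t *: (x - y)) j.
  have xy0 : 0 < `|x - y| + 1 by have := normr_ge0 (x - y); lra.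
  rewrite divr_gt0// => /(_ isT) /near_normP[d d0 Hd].
  apply/(@near_normP _ R^o); exists (d / (`|x - y| + 1)); first exact: divr_gt0.
  move=> s st.
  have E : y + s *: (x - y) - (y + t *: (x - y)) = (s - t) *: (x - y).
    by rewrite opprD addrACA subrr add0r -scalerBl.
  have := Hd (y + s *: (x - y)); rewrite E normrZ.
  have st1 : `|s - t| * `|x - y| <= `|s - t| * (`|x - y| + 1).
    by rewrite ler_wpM2l// lerDl.
  rewrite (le_lt_trans st1) -?ltr_pdivlMr// => /(_ isT) H.
  rewrite /th /dth (_ : _ - _ - _ = F (y + s *: (x - y)) 0 j -
     F (y + t *: (x - y)) 0 j - ((s - t) *: (x - y) *m
       col j (D (y + t *: (x - y)))) 0 0).
    rewrite (le_trans H)// mulrAC -mulrA ler_wpM2l//; first exact: ltW.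
    by rewrite ler_pdivrMr// mulrC.
  rewrite mulmxBr -scalemxAl !mxE.
  rewrite (_ : \sum_(j0 < n) (x - y) 0 j0 * col j (D (y + t *: (x - y))) j0 0 =
     \sum_(j0 < n) (x - y) 0 j0 * (D (y + t *: (x - y))) j0 j); last first.
    by apply: eq_bigr => l _; rewrite !mxE.
  ring.
rewrite /th !scale1r !scale0r addr0 mul1r mul0r subr0 addrCA subrr addr0 => E.
rewrite (_ : _ j = dth t).
  have tr : `|y + t *: (x - y) - xb| <= r.
    by apply: segment_in_ball.
  by rewrite (le_trans (ler_coord_norm _ _ _))//; exact: HD.
by rewrite -E !mxE; ring.
Qed.

Lemma near_id_unit n (S : 'M[R]_n) :
  (forall v : 'rV[R]_n, `|v *m (S - 1%:M)| <= 2^-1 * `|v|) -> S \in unitmx.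
Proof.
move=> HS; rewrite -row_free_unit; apply: inj_row_free => v vS.
have := HS v; rewrite mulmxBr vS mulmx1 sub0r normrN => H.
by apply: normr0_eq0; have := normr_ge0 v; lra.
Qed.

(* [Psi] has derivative 1 at [xb] and [Psi y *m A = Phi y *m P *m A].  Along the
   curve [X t] with [Psi (X t) = t *: Psi y], which joins [xb] to [y], constancy
   of the rank makes the derivative of [Phi (X t) *m l] a multiple of [Psi y *m A]
   with a factor [P *m q (X t)] that is small near [xb] because [D xb *m l = 0]. *)
Lemma constant_rank_vanish n k (Phi : 'rV[R]_n -> 'rV[R]_k)
    (D : 'rV[R]_n -> 'M[R]_(n, k)) (xb : 'rV[R]_n) (l : 'cV[R]_k) :
  (forall z i, has_grad (fun y => Phi y 0 i) z (col i (D z))) ->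
  (forall e : R, 0 < e -> \forall z \near xb, `|D z - D xb| <= e) ->
  (\forall z \near xb, \rank (D z) = \rank (D xb)) ->
  Phi xb = 0 -> D xb *m l = 0 ->
  forall e : R, 0 < e -> \forall y \near xb, `|(Phi y *m l) 0 0| <= e * `|Phi y|.
Proof.
move=> HPhi Dcont Drank Phi0 Al e e0.
set A := D xb.
(* [P] is a generalised inverse of [A], so [A *m P] is idempotent. [Psi] keeps the displacement on
   the complementary projection and replaces the rest by [Phi]; its derivative at [z] is [S z]. *)
have [P APA] : exists P : 'M[R]_(k, n), A *m P *m A = A.
  by exists (pinvmx A); rewrite mulmxKpV.
pose S z : 'M[R]_n := 1%:M - A *m P + D z *m P.
have SB z : S z - 1%:M = (D z - A) *m P.
  by rewrite /S mulmxBl addrC !addrA addNr add0r addrC.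
pose Psi x : 'rV[R]_n := (x - xb) *m (1%:M - A *m P) + Phi x *m P.
have HPsi z i : has_grad (fun y => Psi y 0 i) z (col i (S z)).
  have -> : col i (S z) = 0 + col i (1%:M - A *m P) + D z *m col i P.
    by rewrite add0r /S; apply/colP => j; rewrite !mxE; congr (_ + _);
      apply: eq_bigr => m _; rewrite !mxE.
  have -> : (fun y => Psi y 0 i) = (fun y =>
     (- (xb *m (1%:M - A *m P))) 0 i + (y *m col i (1%:M - A *m P)) 0 0
     + (Phi y *m col i P) 0 0).
    apply/funext => y; rewrite -!mulmx_col /Psi mulmxBl mxE; congr (_ + _).
    by rewrite mxE addrC.
  apply: has_gradD; last exact: has_grad_mulmx.
  by apply: has_gradD; [exact: has_grad_cst|exact: has_grad_linear].
have Psi0 : Psi xb = 0 by rewrite /Psi subrr Phi0 !mul0mx addr0.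
have SA z : S z *m A = D z *m P *m A.
  by rewrite /S mulmxDl mulmxBl mul1mx APA subrr add0r.
have PsiA y : Psi y *m A = Phi y *m P *m A.
  rewrite /Psi mulmxDl -(mulmxA (y - xb)) (mulmxBl 1%:M).
  by rewrite mul1mx APA subrr mulmx0 add0r.
have [C C0 HC] := mulmx_norm_bound 1 (P *m A *m P).
(* [K1] keeps [S z] within one half of the identity near [xb]; [K2] collects the factors of the
   final estimate so that they are absorbed by [e]. *)
pose K1 : R := 2 * (n%:R * k%:R * `|P| + 1).
pose K2 : R := 2 * n%:R * k%:R * C * `|l| + 1.
have nk0 : 0 <= n%:R * k%:R :> R by rewrite mulr_ge0.
have K1_gt0 : 0 < K1 by rewrite /K1; have := mulr_ge0 nk0 (normr_ge0 P); lra.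
have K2_gt0 : 0 < K2.
  have : 0 <= n%:R * k%:R * C * `|l| by rewrite !mulr_ge0// ltW.
  by rewrite /K2; lra.
pose dl : R := Num.min (K1^-1) (e / K2).
have dl0 : 0 < dl by rewrite lt_min invr_gt0 K1_gt0 divr_gt0.
have /near_normP[r' r'0 Hr'] : \forall z \near xb,
    `|D z - A| <= dl /\ \rank (D z) = \rank A.
  by near=> z; split; near: z; [exact: Dcont|exact: Drank].
pose r : R := r' / 2; have r0 : 0 < r by rewrite /r; lra.
have Dle z : `|z - xb| <= r -> `|D z - A| <= dl.
  by move=> zr; case: (Hr' z) => //; move: zr; rewrite /r; lra.
have Drk z : `|z - xb| <= r -> \rank (D z) = \rank A.
  by move=> zr; case: (Hr' z) => //; move: zr; rewrite /r; lra.
have SB_le z : `|z - xb| <= r -> n%:R * `|S z - 1%:M| <= 2^-1.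
  move=> /Dle zr; rewrite SB.
  have H1 : n%:R * `|(D z - A) *m P| <= n%:R * k%:R * `|P| * dl.
    rewrite -!mulrA ler_wpM2l// (le_trans (ler_norm_mulmx _ _))//.
    by rewrite -mulrA ler_wpM2l// mulrC ler_wpM2l.
  apply: (le_trans H1).
  have H2 : n%:R * k%:R * `|P| * dl <= n%:R * k%:R * `|P| * K1^-1.
    by rewrite ler_wpM2l ?mulr_ge0// ge_min lexx.
  apply: (le_trans H2); rewrite ler_pdivrMr// /K1 mulrA mulVf// mul1r.
  by lra.
have Sv z : `|z - xb| <= r -> forall v : 'rV[R]_n,
    `|v *m (S z - 1%:M)| <= 2^-1 * `|v|.
  move=> /SB_le zr v; rewrite (le_trans (ler_norm_mulmx _ _))//.
  by rewrite mulrAC ler_wpM2r.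
have Sunit z : `|z - xb| <= r -> S z \in unitmx.
  by move=> /Sv; exact: near_id_unit.
pose q z : 'cV[R]_n := invmx (S z) *m (D z *m l).
have Sq z : `|z - xb| <= r -> S z *m q z = D z *m l.
  by move=> zr; rewrite /q mulmxA mulmxV ?mul1mx// Sunit.
have q_le z : `|z - xb| <= r -> `|q z| <= 2 * (k%:R * dl * `|l|).
  move=> zr.
  have H1 : `|(S z - 1%:M) *m q z| <= 2^-1 * `|q z|.
    by rewrite (le_trans (ler_norm_mulmx _ _))// ler_wpM2r// SB_le.
  have H2 : `|D z *m l| <= k%:R * dl * `|l|.
    have -> : D z *m l = (D z - A) *m l by rewrite mulmxBl Al subr0.
    rewrite (le_trans (ler_norm_mulmx _ _))// ler_wpM2r// ler_wpM2l//.
    exact: Dle.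
  have := ler_normB (D z *m l) ((S z - 1%:M) *m q z).
  rewrite -(Sq z zr) -mulmxBl opprB addrCA subrr addr0 mul1mx (Sq z zr).
  lra.
(* Constancy of the rank enters here. The columns of [S z *m A = D z *m P *m A] are combinations of
   those of [D z], and both matrices have the rank of [A], so [D z] factors as [S z *m A *m Y^T].
   Hence [q z] lies in the column space of [A], on which [A *m P] is the identity. *)
have DAP z : `|z - xb| <= r -> S z *m (A *m P *m q z) = D z *m l.
  move=> zr.
  have rkSA : \rank (S z *m A) = \rank A.
    by rewrite -mxrank_tr trmx_mul mxrankMfree ?mxrank_tr// row_free_unit
         unitmx_tr Sunit.
  have sub : ((S z *m A)^T <= (D z)^T)%MS.
    by rewrite SA -mulmxA trmx_mul submxMl.
  have : ((D z)^T <= (S z *m A)^T)%MS.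
    by rewrite -(mxrank_leqif_sup sub) !mxrank_tr rkSA Drk.
  move=> /submxP[Y /(congr1 trmx)]; rewrite trmx_mul !trmxK => DE.
  have E : q z = A *m Y^T *m l.
    by rewrite /q {1}DE -!mulmxA mulKmx ?Sunit.
  rewrite E [in RHS]DE -!mulmxA; congr (_ *m _).
  by rewrite !mulmxA APA.
have Psi_near x y : `|x - xb| <= r -> `|y - xb| <= r ->
    `|Psi x - Psi y - (x - y)| <= 2^-1 * `|x - y|.
  have h0 : (0 : R) <= 2^-1 by rewrite invr_ge0 ler0n.
  by move=> xr yr; have := near_mean_value h0 HPsi Sv xr yr; rewrite mulmx1.
have Psi_inv x y : `|x - xb| <= r -> `|y - xb| <= r ->
    `|x - y| <= 2 * `|Psi x - Psi y|.
  move=> xr yr; have := Psi_near x y xr yr; rewrite distrC.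
  have := ler_normD (x - y - (Psi x - Psi y)) (Psi x - Psi y).
  by rewrite subrK; lra.
have Psi_lip x : `|x - xb| <= r -> `|Psi x| <= 2 * `|x - xb|.
  move=> xr; have := Psi_near x xb xr.
  rewrite subrr normr0 (ltW r0) Psi0 subr0 => /(_ isT).
  have := ler_normD (Psi x - (x - xb)) (x - xb).
  by rewrite subrK; have := normr_ge0 (x - xb); lra.
(* Since [Psi] is 2-Lipschitz at [xb], this radius gives [|Psi y| <= r / 10], so [t *: Psi y] for
   [|t| <= 2] is in the range [r / 5] of [near_identity_surj]. *)
apply/near_normP; exists (r / 20); first lra.
move=> y yr20.
have yr : `|y - xb| <= r by lra.
have Psiy : `|Psi y| <= r / 10 by have := Psi_lip y yr; lra.
(* Going up to [|t| = 2] leaves room for two-sided increments at 0 and 1; for larger [|t|] the value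
   [xb] is a mere default. *)
have /choice[X HX] : forall t : R, exists x : 'rV[R]_n, `|t| <= 2 ->
    `|x - xb| <= r /\ Psi x = t *: Psi y.
  move=> t; have [t2|t2] := boolP (`|t| <= 2); last by exists xb.
  have [|x xr Px] := near_identity_surj r0 Psi0 Psi_near (w := t *: Psi y).
    rewrite normrZ; have : `|t| * `|Psi y| <= 2 * (r / 10) by rewrite ler_pM.
    by lra.
  by exists x.
have t2 (t : R) : 0 <= t <= 1 -> `|t| <= 2.
  by move=> /andP[t0 t1]; rewrite ger0_norm//; lra.
have X1 : X 1 = y.
  have [X1r X1P] := HX 1 (t2 1 ltac:(by rewrite ler01 lexx)).
  apply/subr0_eq/normr0_eq0; have := Psi_inv _ _ X1r yr.
  by rewrite X1P scale1r subrr normr0; have := normr_ge0 (X 1 - y); lra.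
have X0 : X 0 = xb.
  have [X0r X0P] := HX 0 (t2 0 ltac:(by rewrite ler01 lexx)).
  have xbr : `|xb - xb| <= r by rewrite subrr normr0 ltW.
  apply/subr0_eq/normr0_eq0; have := Psi_inv _ _ X0r xbr.
  by rewrite X0P Psi0 scale0r subrr normr0; have := normr_ge0 (X 0 - xb); lra.
pose th t : R := (Phi (X t) *m l) 0 0.
pose dth t : R := (Psi y *m (A *m P *m q (X t))) 0 0.
have [t t01 e1 e10|t t01] := @mean_value01 R th dth.
  have [Xtr XtP] := HX t (t2 t t01).
  pose a := A *m P *m q (X t).
  (* By [DAP] the difference of [Phi . l] and [Psi . a] has zero gradient at [X t]. As [Psi (X s)]
     is linear in [s] and [X] is Lipschitz by [Psi_inv], this yields the derivative of [th] without
     differentiating [X]. *)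
  have Hz : has_grad (fun x => (Phi x *m l) 0 0 + (Psi x *m (- a)) 0 0) (X t) 0.
    have -> : 0 = D (X t) *m l + S (X t) *m (- a).
      by rewrite mulmxN DAP// subrr.
    by apply: has_gradD; exact: has_grad_mulmx.
  have yy0 : 0 < 2 * `|Psi y| + 1 by have := normr_ge0 (Psi y); lra.
  have /near_normP[d d0 Hd] := Hz _ (divr_gt0 e10 yy0).
  pose d1 : R := Num.min 1 (d / (2 * `|Psi y| + 1)).
  apply/(@near_normP _ R^o); exists d1; first by rewrite lt_min ltr01 divr_gt0.
  move=> s; rewrite lt_min => /andP[st1 std].
  have s2 : `|s| <= 2.
    have := ler_normD (s - t) t; rewrite subrK.
    by case/andP : t01 => ? ?; rewrite [`|t|]ger0_norm//; lra.
  have [Xsr XsP] := HX s s2.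
  have Xst : `|X s - X t| <= `|s - t| * (2 * `|Psi y| + 1).
    rewrite (le_trans (Psi_inv _ _ Xsr Xtr))// XsP XtP -scalerBl normrZ.
    by have := normr_ge0 (s - t); lra.
  have := Hd (X s); rewrite (le_lt_trans Xst) -?ltr_pdivlMr// => /(_ isT).
  rewrite mulmx0 !mxE subr0 => H.
  have -> : th s - th t - dth t * (s - t) =
      (\sum_j (Phi (X s)) 0 j * l j 0 + \sum_j (Psi (X s)) 0 j * (- a) j 0) -
      (\sum_j (Phi (X t)) 0 j * l j 0 + \sum_j (Psi (X t)) 0 j * (- a) j 0).
    have Ea x : \sum_j (Psi x) 0 j * (- a) j 0 = - (Psi x *m a) 0 0.
      by rewrite mxE -sumrN; apply: eq_bigr => i _; rewrite !mxE mulrN.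
    have Eb x : \sum_j (Phi x) 0 j * l j 0 = (Phi x *m l) 0 0 by rewrite mxE.
    have Ec (c : R) : ((c *: Psi y) *m a) 0 0 = c * (Psi y *m a) 0 0.
      by rewrite -scalemxAl mxE.
    by rewrite !Ea !Eb XsP XtP !Ec /th /dth -/a; ring.
  rewrite (le_trans H)// -mulrA ler_wpM2l//; first exact: ltW.
  by rewrite mulrC ler_pdivrMr.
rewrite /th X1 X0 Phi0 mul0mx [X in _ - X]mxE subr0 => ->.
have [Xtr _] := HX t (t2 t t01).
rewrite /dth -mulmxA (mulmxA (Psi y)) PsiA.
have -> : Phi y *m P *m A *m (P *m q (X t)) = Phi y *m (P *m A *m P) *m q (X t).
  by rewrite !mulmxA.
rewrite (le_trans (ler_coord_norm _ _ _))// (le_trans (ler_norm_mulmx _ _))//.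
have H1 : `|Phi y *m (P *m A *m P)| * `|q (X t)| <=
    C * `|Phi y| * (2 * (k%:R * dl * `|l|)) by rewrite ler_pM// q_le.
rewrite -mulrA; apply: (le_trans (ler_wpM2l _ H1)) => //.
rewrite (_ : n%:R * _ = 2 * n%:R * k%:R * C * `|l| * dl * `|Phi y|); last by ring.
rewrite ler_wpM2r//.
have : K2 * dl <= e by rewrite mulrC -ler_pdivlMr// ge_min lexx orbT.
by rewrite /K2; lra.
Unshelve. all: by end_near. Qed.

End ConstantRankVanish.

(** * The penalisation argument *)

Section CvgMinMaxSum.
Variables (R : realType) (T : Type) (F : set_system T) (FF : Filter F).

Lemma cvg_minr (f g : T -> R) (a b : R) : f x @[x --> F] --> a ->
  g x @[x --> F] --> b -> Num.min (f x) (g x) @[x --> F] --> Num.min a b.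
Proof.
by move=> fa gb; apply: (continuous2_cvg FF (@min_continuous _ R (a, b)) fa gb).
Qed.

Lemma cvg_maxr (f g : T -> R) (a b : R) : f x @[x --> F] --> a ->
  g x @[x --> F] --> b -> Num.max (f x) (g x) @[x --> F] --> Num.max a b.
Proof.
by move=> fa gb; apply: (continuous2_cvg FF (@max_continuous _ R (a, b)) fa gb).
Qed.

Lemma cvg_sumr (I : Type) (r : seq I) (P : pred I) (f : I -> T -> R)
    (a : I -> R) :
  (forall i, f i x @[x --> F] --> a i) ->
  \sum_(i <- r | P i) f i x @[x --> F] --> \sum_(i <- r | P i) a i.
Proof. by move=> H; apply: cvg_big => //; exact: add_continuous. Qed.

Lemma cvg_sqr (f : T -> R) (a : R) : f x @[x --> F] --> a ->
  (f x) ^+ 2 @[x --> F] --> a ^+ 2.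
Proof.
by move=> fa; rewrite expr2; under eq_fun do rewrite expr2; exact: cvgM.
Qed.

End CvgMinMaxSum.

(** * Distances in an arbitrary norm *)

Section Distance.
Variables (R : realType) (n : nat).

Lemma is_norm_mx_norm : is_norm (fun x : 'rV[R]_n => `|x|).
Proof. by split; [exact: ler_normD|exact: normrZ|exact: normr0_eq0]. Qed.

Variables (N : 'rV[R]_n -> R) (HN : is_norm N).

Lemma is_norm0 : N 0 = 0.
Proof. by have := norm_scale HN 0 0; rewrite scale0r normr0 mul0r. Qed.

Lemma is_normN x : N (- x) = N x.
Proof. by rewrite -scaleN1r (norm_scale HN) normrN1 mul1r. Qed.

Lemma is_norm_ge0 x : 0 <= N x.
Proof.
have := norm_triangle HN x (- x); rewrite subrr is_norm0 is_normN; lra.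
Qed.

Lemma dist_lbound (A : set 'rV[R]_n) z : has_lbound [set N (z - y) | y in A].
Proof. by exists 0 => _ [y _ <-]; exact: is_norm_ge0. Qed.

Lemma dist_le (A : set 'rV[R]_n) z y : A y -> dist N A z <= N (z - y).
Proof. by move=> Ay; apply: (ge_inf (dist_lbound A z)); exists y. Qed.

Lemma dist_adherent (A : set 'rV[R]_n) z e : A !=set0 -> 0 < e ->
  exists2 y, A y & N (z - y) < dist N A z + e.
Proof.
move=> [y Ay] e0; have [|_ [x Ax <-] xe] := @inf_adherent _
    [set N (z - y) | y in A] _ e0.
  by split; [exists (N (z - y)), y|exact: dist_lbound].
by exists x.
Qed.

End Distance.

(** * The Euclidean residual and its almost stationary points *)

Section Residual.
Variables (R : realType) (n p q m : nat) (P : mpsc R n p q m).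
Local Notation g := (mpsc_g P).
Local Notation h := (mpsc_h P).
Local Notation G := (mpsc_G P).
Local Notation H := (mpsc_H P).

(** The violations summed in [residual] are squared here, which makes each branch of the minimum a
    differentiable function. *)
Definition sq_residual (z : 'rV[R]_n) : R :=
  \sum_(i < p) (Num.max 0 (g z 0 i)) ^+ 2 + \sum_(j < q) (h z 0 j) ^+ 2
  + \sum_(i < m) (Num.min `|G z 0 i| `|H z 0 i|) ^+ 2.

Definition residual2 z : R := Num.sqrt (sq_residual z).

(** The local form of the conclusion of Ekeland's variational principle: [y] minimises [residual2]
    perturbed by a cone of slope [e] with apex [y]. *)
Definition almost_stationary (e : R) (y : 'rV[R]_n) : Prop :=
  \forall x \near y, residual2 y <= residual2 x + e * `|x - y|.

Lemma max0_ge0 (x : R) : 0 <= Num.max 0 x.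
Proof. by rewrite le_max lexx. Qed.

Lemma min_norm_ge0 (x y : R) : 0 <= Num.min `|x| `|y|.
Proof. by rewrite le_min !normr_ge0. Qed.

Lemma sq_residual_parts z :
  [/\ 0 <= \sum_(i < p) (Num.max 0 (g z 0 i)) ^+ 2,
      0 <= \sum_(j < q) (h z 0 j) ^+ 2 &
      0 <= \sum_(i < m) (Num.min `|G z 0 i| `|H z 0 i|) ^+ 2].
Proof. by split; apply: sumr_ge0 => i _; exact: sqr_ge0. Qed.

Lemma sq_residual_ge0 z : 0 <= sq_residual z.
Proof. by have [? ? ?] := sq_residual_parts z; rewrite /sq_residual; lra. Qed.

Lemma residual2_ge0 z : 0 <= residual2 z.
Proof. exact: sqrtr_ge0. Qed.

Lemma sqr_residual2 z : residual2 z ^+ 2 = sq_residual z.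
Proof. exact: sqr_sqrtr (sq_residual_ge0 z). Qed.

Lemma ler_sum_sqr (I : finType) (f : I -> R) i : (f i) ^+ 2 <= \sum_j (f j) ^+ 2.
Proof.
rewrite (bigD1 i)//= lerDl; apply: sumr_ge0 => j _; exact: sqr_ge0.
Qed.

Lemma le_residual2 (x : R) z : 0 <= x -> x ^+ 2 <= sq_residual z ->
  x <= residual2 z.
Proof.
by move=> x0; rewrite -sqr_residual2 ler_pXn2r// nnegrE// residual2_ge0.
Qed.

Lemma residual2_g z i : Num.max 0 (g z 0 i) <= residual2 z.
Proof.
apply: le_residual2; first exact: max0_ge0.
have := ler_sum_sqr (fun i => Num.max 0 (g z 0 i)) i.
by have [? ? ?] := sq_residual_parts z; rewrite /sq_residual; lra.
Qed.

Lemma residual2_h z i : `|h z 0 i| <= residual2 z.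
Proof.
apply: le_residual2 => //; rewrite real_normK ?num_real//.
have := ler_sum_sqr (fun i => h z 0 i) i.
by have [? ? ?] := sq_residual_parts z; rewrite /sq_residual; lra.
Qed.

Lemma residual2_GH z i : Num.min `|G z 0 i| `|H z 0 i| <= residual2 z.
Proof.
apply: le_residual2; first exact: min_norm_ge0.
have := ler_sum_sqr (fun i => Num.min `|G z 0 i| `|H z 0 i|) i.
by have [? ? ?] := sq_residual_parts z; rewrite /sq_residual; lra.
Qed.

Lemma residual2_eq0_feasible z : residual2 z = 0 -> feasible P z.
Proof.
move=> z0; split=> i.
- by have := residual2_g z i; rewrite z0 ge_max => /andP[].
- by apply/eqP; rewrite -normr_le0 -z0; exact: residual2_h.
- apply/eqP; rewrite mulf_eq0 -!normr_le0.
  by have := residual2_GH z i; rewrite z0 ge_min.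
Qed.

Lemma ler_sqr_sum (I : finType) (f : I -> R) : (forall i, 0 <= f i) ->
  \sum_i (f i) ^+ 2 <= (\sum_i f i) ^+ 2.
Proof.
move=> f0; rewrite [leRHS]expr2 mulr_suml ler_sum// => i _.
rewrite expr2 ler_wpM2l// (bigD1 i)//= lerDl; exact: sumr_ge0.
Qed.

(** For nonnegative entries the mixed products in the squared sum are nonnegative. Thus a failing
    error bound for [residual] also fails for [residual2]. *)
Lemma residual2_le_residual z : residual2 z <= residual P z.
Proof.
set a := \sum_(i < p) Num.max 0 (g z 0 i).
set b := \sum_(j < q) `|h z 0 j|.
set c := \sum_(i < m) Num.min `|G z 0 i| `|H z 0 i|.
have a0 : 0 <= a by apply: sumr_ge0 => i _; exact: max0_ge0.
have b0 : 0 <= b by apply: sumr_ge0.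
have c0 : 0 <= c by apply: sumr_ge0 => i _; exact: min_norm_ge0.
have r0 : 0 <= residual P z by rewrite /residual -/a -/b -/c; lra.
rewrite -(@ler_pXn2r _ 2)// ?nnegrE ?residual2_ge0// sqr_residual2.
have Ha := ler_sqr_sum (fun i => max0_ge0 (g z 0 i)).
have Hb := ler_sqr_sum (fun i => normr_ge0 (h z 0 i)).
have Hc := ler_sqr_sum (fun i => min_norm_ge0 (G z 0 i) (H z 0 i)).
have Hb' : \sum_(j < q) (h z 0 j) ^+ 2 <= b ^+ 2.
  by apply: le_trans Hb; apply: ler_sum => i _; rewrite real_normK ?num_real.
rewrite /sq_residual /residual -/a -/b -/c.
have : 0 <= a * b by rewrite mulr_ge0.
have : 0 <= b * c by rewrite mulr_ge0.
have : 0 <= a * c by rewrite mulr_ge0.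
rewrite -/a in Ha; rewrite -/c in Hc.
rewrite (_ : (a + b + c) ^+ 2 = a ^+ 2 + b ^+ 2 + c ^+ 2 +
  2 * (a * b) + 2 * (b * c) + 2 * (a * c)); [lra|ring].
Qed.

Lemma residual2_cvg (F : set_system 'rV[R]_n) (FF : Filter F) z :
  (forall i, g y 0 i @[y --> F] --> g z 0 i) ->
  (forall i, h y 0 i @[y --> F] --> h z 0 i) ->
  (forall i, G y 0 i @[y --> F] --> G z 0 i) ->
  (forall i, H y 0 i @[y --> F] --> H z 0 i) ->
  residual2 y @[y --> F] --> residual2 z.
Proof.
move=> cg ch cG cH.
apply: (@cvg_comp _ _ _ sq_residual Num.sqrt _ (nbhs (sq_residual z)));
  last exact: sqrt_continuous.
apply: cvgD; [apply: cvgD|]; apply: cvg_sumr => i.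
- exact: (cvg_sqr FF (cvg_maxr FF (cvg_cst 0) (cg i))).
- exact: (cvg_sqr FF (ch i)).
- exact: (cvg_sqr FF (cvg_minr FF (cvg_norm (cG i)) (cvg_norm (cH i)))).
Qed.

Hypothesis P_C1 : mpsc_C1 P.

Lemma has_grad_g z i : has_grad (fun y => g y 0 i) z (grad g i z).
Proof. by case: P_C1 => _ [dg _] _ _ _; exact: differentiable_has_grad. Qed.
Lemma has_grad_h z i : has_grad (fun y => h y 0 i) z (grad h i z).
Proof. by case: P_C1 => _ _ [dg _] _ _; exact: differentiable_has_grad. Qed.
Lemma has_grad_G z i : has_grad (fun y => G y 0 i) z (grad G i z).
Proof. by case: P_C1 => _ _ _ [dg _] _; exact: differentiable_has_grad. Qed.
Lemma has_grad_H z i : has_grad (fun y => H y 0 i) z (grad H i z).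
Proof. by case: P_C1 => _ _ _ _ [dg _]; exact: differentiable_has_grad. Qed.

Lemma residual2_continuous z : {for z, continuous residual2}.
Proof.
have cg i := has_grad_continuous (has_grad_g z i).
have ch i := has_grad_continuous (has_grad_h z i).
have cG i := has_grad_continuous (has_grad_G z i).
have cH i := has_grad_continuous (has_grad_H z i).
exact: (residual2_cvg (nbhs_filter z) cg ch cG cH).
Qed.

Local Notation sdist := (dist (fun x : 'rV[R]_n => `|x|) (feasible P)).

(** An Ekeland argument in which compactness of the ball around the bad point [z], with [zs] on its
    boundary, provides the minimiser. *)
Lemma no_error_bound_almost_stationary zs : feasible P zs ->
  (forall alpha : R, 0 < alpha ->
     ~ \forall z \near zs, sdist z <= alpha * residual P z) ->
  forall e : R, 0 < e -> exists y : 'rV[R]_n,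
    [/\ 0 < residual2 y, `|y - zs| < e, residual2 y <= e * `|y - zs|
      & almost_stationary e y].
Proof.
move=> zsF noEB e e0.
have HN := is_norm_mx_norm R n.
(* With the constant [2 / e], minimality against [z] gives [|y - z| < sdist z / 2], so [y] is
   infeasible and [|y - zs|] is at least half of [|z - zs|]. The radius [e / 2] then leaves [y]
   within [e] of [zs]. *)
have [z [zse zd]] : exists z, `|z - zs| < e / 2 /\ 2 / e * residual P z < sdist z.
  apply: contrapT => H; apply: (noEB (2 / e)); first by rewrite divr_gt0.
  apply/near_normP; exists (e / 2); first by lra.
  move=> z zse; rewrite leNgt; apply/negP => zd; apply: H; by exists z.
have Fn0 : feasible P !=set0 by exists zs.
have dz : sdist z <= `|z - zs| := dist_le HN z zsF.
have e2s : residual2 z < e * sdist z / 2.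
  apply: le_lt_trans (residual2_le_residual z) _.
  rewrite -(@ltr_pM2l _ (2 / e)); last by rewrite divr_gt0.
  rewrite (le_lt_trans _ (lt_le_trans zd _))// le_eqVlt; apply/orP; left.
  by apply/eqP; field; rewrite gt_eqF.
have r0 := residual2_ge0 z.
have dz0 : 0 < sdist z by rewrite -(pmulr_rgt0 _ e0); lra.
have zzs0 : 0 < `|z - zs| by exact: lt_le_trans dz0 dz.
have [||y + ymin] := @EVT_min_rV R n (fun x => residual2 x + e * `|x - z|)
    [set x | `|x - z| <= `|z - zs|] _ (closed_ball_rV_compact z _).
- by exists z => /=; rewrite subrr normr0 ltW.
- apply: within_continuous_norm => x _ e1 e10.
  have /near_normP[d d0 Hd] : \forall y \near x, `|residual2 y - residual2 x| <= e1 / 2.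
    by have /continuous_nearP := @residual2_continuous x; apply; lra.
  exists (Num.min d (e1 / 2 / e)); first by rewrite lt_min d0 !divr_gt0//; lra.
  move=> y _; rewrite lt_min => /andP[/Hd yd ye].
  rewrite opprD addrACA -mulrBr (le_trans (ler_normD _ _))//.
  have : `|e * (`|y - z| - `|x - z|)| <= e1 / 2.
    rewrite normrM gtr0_norm// -ler_pdivlMl// mulrC (le_trans _ (ltW ye))//.
    by rewrite (le_trans (ler_dist_dist _ _))// opprB addrA subrK.
  by lra.
rewrite inE /= => yr.
have ymin' x : `|x - z| <= `|z - zs| ->
    residual2 y + e * `|y - z| <= residual2 x + e * `|x - z|.
  by move=> xr; apply: ymin; rewrite inE.
have := ymin' z; rewrite subrr normr0 => /(_ (ltW zzs0)); rewrite mulr0 addr0 => yz.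
have ry0 := residual2_ge0 y.
have yz_d : `|y - z| < sdist z / 2.
  by rewrite -(@ltr_pM2l _ e)//; lra.
have y_zs : `|z - zs| <= 2 * `|y - zs|.
  by have := ler_normD (z - y) (y - zs); rewrite addrA subrK (distrC z y); lra.
exists y; split.
- rewrite lt_neqAle ry0 andbT eq_sym; apply/eqP => /residual2_eq0_feasible yF.
  by have := dist_le HN z yF; rewrite distrC; lra.
- by have := ler_normD (y - z) (z - zs); rewrite addrA subrK; lra.
- have : 0 <= e * `|y - z| by rewrite mulr_ge0// ltW.
  have : e * sdist z <= e * (2 * `|y - zs|).
    by rewrite ler_wpM2l ?(ltW e0)// (le_trans dz).
  by lra.
(* As [|y - z| < |z - zs| / 2], this neighbourhood of [y] lies in the ball over which [y] is
   minimal. *)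
- apply/near_normP; exists (`|z - zs| / 2); first by lra.
  move=> x xy.
  have xz : `|x - z| <= `|x - y| + `|y - z|.
    by have := ler_normD (x - y) (y - z); rewrite addrA subrK.
  have := ymin' x; have xz1 : `|x - z| <= `|z - zs| by lra.
  move=> /(_ xz1).
  have : e * `|x - z| <= e * (`|x - y| + `|y - z|) by rewrite ler_wpM2l// ltW.
  by lra.
Qed.

End Residual.

(** * Multipliers at an almost stationary point *)

Section Criticality.
Variables (R : realType) (n : nat).

(** Moving from [y] along [v] and dividing by the step length bounds the slope below by [- c * |v|];
    the same bound for [- v] is the other half. *)
Lemma grad_norm_le (f : 'rV[R]_n -> R) (y : 'rV[R]_n) (a : 'cV[R]_n) (c : R) :
  has_grad f y a -> (\forall x \near y, f y - c * `|x - y| <= f x) ->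
  forall v : 'rV[R]_n, `|(v *m a) 0 0| <= c * `|v|.
Proof.
move=> Hf fmin.
have lower (v : 'rV[R]_n) : - (v *m a) 0 0 <= c * `|v|.
  apply/ler_addgt0Pr => e e0.
  have v0 : 0 < `|v| + 1 by have := normr_ge0 v; lra.
  have ev0 : 0 < e / (`|v| + 1) by rewrite divr_gt0.
  have /near_normP[d d0 Hd] : \forall x \near y,
      `|f x - f y - ((x - y) *m a) 0 0| <= e / (`|v| + 1) * `|x - y| /\
      f y - c * `|x - y| <= f x.
    by near=> x; split; near: x => //; exact: Hf.
  (* This step stays inside the neighbourhood of radius [d], and the tolerance [e / (|v| + 1)] makes
     the remainder at most [e * t]. *)
  pose t : R := d / 2 / (`|v| + 1).
  have t0 : 0 < t by rewrite !divr_gt0.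
  have := Hd (y + t *: v); rewrite addrC addKr normrZ gtr0_norm//.
  have tv : t * `|v| < d.
    rewrite /t mulrAC ltr_pdivrMr//.
    have : 0 < d * (`|v| + 1) by rewrite mulr_gt0.
    by have := mulr_ge0 (ltW d0) (normr_ge0 v); lra.
  move=> /(_ tv)[]; rewrite -scalemxAl mxE ler_norml => /andP[_ H1] H2.
  have H3 : e / (`|v| + 1) * (t * `|v|) <= e * t.
    rewrite mulrAC -mulrA ler_wpM2l ?(ltW e0)// ler_pdivrMr//.
    by rewrite ler_wpM2l ?(ltW t0)// lerDl.
  by rewrite -(@ler_pM2l _ t)//; lra.
move=> v; rewrite ler_norml; apply/andP; split.
  by have := lower v; lra.
by have := lower (- v); rewrite mulNmx mxE opprK normrN.
Unshelve. all: by end_near. Qed.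

(** Regroups a sum that picks one of two columns per index into two full multiplier blocks; [2 * s]
    is the factor relating the gradient of a squared function to that of the function itself. *)
Lemma branch_combination m (A B : 'M[R]_(n, m)) (u v : 'I_m -> R)
    (b : {set 'I_m}) (s : R) : 0 < s ->
  (2 * s) *: (A *m \col_i ((if i \in b then u i else 0) / s))
  + (2 * s) *: (B *m \col_i ((if i \in b then 0 else v i) / s))
  = \sum_i (2 * (if i \in b then u i else v i)) *:
      (if i \in b then col i A else col i B).
Proof.
move=> s0; rewrite (mulmx_sum_col A) (mulmx_sum_col B) 2!scaler_sumr -big_split/=.
apply: eq_bigr => i _; rewrite !scalerA 2!mxE.
by case: ifP => _; rewrite mul0r mulr0 scale0r ?addr0 ?add0r; congr (_ *: _);
  field; rewrite gt_eqF.
Qed.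

End Criticality.

Section PenaltyMultipliers.
Variables (R : realType) (n p q m : nat) (P : mpsc R n p q m).
Local Notation g := (mpsc_g P).
Local Notation h := (mpsc_h P).
Local Notation G := (mpsc_G P).
Local Notation H := (mpsc_H P).

(** Violations divided by their Euclidean norm. On an active branch [b] the four vectors are the
    coefficients of the gradient of the root of the branch sum of squares. *)
Definition mult_g y : 'cV[R]_p := \col_i (Num.max 0 (g y 0 i) / residual2 P y).
Definition mult_h y : 'cV[R]_q := \col_i (h y 0 i / residual2 P y).
Definition mult_G (b : {set 'I_m}) y : 'cV[R]_m :=
  \col_i ((if i \in b then G y 0 i else 0) / residual2 P y).
Definition mult_H (b : {set 'I_m}) y : 'cV[R]_m :=
  \col_i ((if i \in b then 0 else H y 0 i) / residual2 P y).

Definition active_branch (b : {set 'I_m}) y : Prop := forall i,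
  if i \in b then `|G y 0 i| <= `|H y 0 i| else `|H y 0 i| <= `|G y 0 i|.

Lemma active_branch_min b y i : active_branch b y ->
  (Num.min `|G y 0 i| `|H y 0 i|) = `|if i \in b then G y 0 i else H y 0 i|.
Proof. by move=> /(_ i); case: ifP => _ ?; [rewrite min_l|rewrite min_r]. Qed.

Hypothesis P_C1 : mpsc_C1 P.

(** The branch function [Q] is differentiable at [y], dominates the squared residual everywhere and
    equals it at [y]. Almost stationarity therefore bounds the slope of [Q], and the factor [2 * s]
    due to squaring cancels. *)
Lemma almost_stationary_multipliers e y b :
  0 < e -> 0 < residual2 P y -> almost_stationary P e y -> active_branch b y ->
  forall v : 'rV[R]_n,
    `|(v *m ('J g y *m mult_g y + 'J h y *m mult_h y
             + 'J G y *m mult_G b y + 'J H y *m mult_H b y)) 0 0| <= e * `|v|.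
Proof.
move=> e0 s0 stat by_ v.
set s := residual2 P y in s0 *.
pose Q x : R := \sum_(i < p) (Num.max 0 (g x 0 i)) ^+ 2
  + \sum_(j < q) (h x 0 j) ^+ 2
  + \sum_(i < m) (if i \in b then G x 0 i else H x 0 i) ^+ 2.
set a := (X in v *m X).
have HQ : has_grad Q y ((2 * s) *: a).
  pose dQ := \sum_(i < p) (2 * Num.max 0 (g y 0 i)) *: grad g i y
    + \sum_(j < q) (2 * h y 0 j) *: grad h j y
    + \sum_(i < m) (2 * (if i \in b then G y 0 i else H y 0 i)) *:
        (if i \in b then grad G i y else grad H i y).
  have -> : (2 * s) *: a = dQ.
    have Eg : (2 * s) *: ('J g y *m mult_g y) =
        \sum_(i < p) (2 * Num.max 0 (g y 0 i)) *: grad g i y.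
      rewrite mulmx_sum_col scaler_sumr; apply: eq_bigr => i _.
      rewrite scalerA mxE; congr (_ *: _).
      by rewrite -/s; field; rewrite gt_eqF.
    have Eh : (2 * s) *: ('J h y *m mult_h y) =
        \sum_(i < q) (2 * h y 0 i) *: grad h i y.
      rewrite mulmx_sum_col scaler_sumr; apply: eq_bigr => i _.
      rewrite scalerA mxE; congr (_ *: _).
      by rewrite -/s; field; rewrite gt_eqF.
    have EGH : (2 * s) *: ('J G y *m mult_G b y) + (2 * s) *: ('J H y *m mult_H b y) =
        \sum_(i < m) (2 * (if i \in b then G y 0 i else H y 0 i)) *:
        (if i \in b then grad G i y else grad H i y).
      exact: branch_combination.
    by rewrite /a /dQ -Eg -Eh -EGH 3!scalerDr addrA.
  apply: has_gradD; [apply: has_gradD|]; apply: has_grad_sum => i.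
  - by apply: has_grad_pos_sqr; exact: has_grad_g.
  - by apply: has_grad_sqr; exact: has_grad_h.
  - by case: ifP => _; apply: has_grad_sqr; [exact: has_grad_G|exact: has_grad_H].
have Qy : Q y = s ^+ 2.
  rewrite sqr_residual2; congr (_ + _); apply: eq_bigr => i _.
  by rewrite (active_branch_min i by_) real_normK ?num_real.
have Qge x : (residual2 P x) ^+ 2 <= Q x.
  rewrite sqr_residual2 lerD2l ler_sum// => i _.
  rewrite -[leRHS]real_normK ?num_real// ler_pXn2r ?nnegrE ?min_norm_ge0//.
  by rewrite ge_min; case: ifP; rewrite lexx ?orbT.
have nearQ : \forall x \near y, Q y - (2 * s * e) * `|x - y| <= Q x.
  (* Within distance [s / e] of [y] the lower bound [s - e * |x - y|] is nonnegative and may be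
     squared. *)
  have se0 : 0 < s / e by rewrite divr_gt0.
  have small := near_norm_le y se0.
  near=> x; apply: le_trans (Qge x); rewrite Qy.
  have H1 : s <= residual2 P x + e * `|x - y| by near: x; exact: stat.
  have H2 : e * `|x - y| <= s by rewrite mulrC -ler_pdivlMr//; near: x.
  have H3 : (s - e * `|x - y|) ^+ 2 <= (residual2 P x) ^+ 2.
    by rewrite ler_pXn2r ?nnegrE ?residual2_ge0//; lra.
  apply: le_trans H3; rewrite !expr2.
  have : 0 <= (e * `|x - y|) ^+ 2 by exact: sqr_ge0.
  by rewrite expr2; lra.
have := grad_norm_le HQ nearQ v.
rewrite -scalemxAr mxE normrM gtr0_norm ?mulr_gt0// -mulrA -!mulrA.
by rewrite !ler_pM2l.
Unshelve. all: by end_near. Qed.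

Lemma mult_norm1 y b : 0 < residual2 P y -> active_branch b y ->
  \sum_i (mult_g y i 0) ^+ 2 + \sum_i (mult_h y i 0) ^+ 2
  + \sum_i (mult_G b y i 0) ^+ 2 + \sum_i (mult_H b y i 0) ^+ 2 = 1.
Proof.
move=> s0 by_; have s2 : residual2 P y ^+ 2 != 0 by rewrite expf_neq0// gt_eqF.
rewrite -addrA -big_split/=.
have E (k : nat) (F : 'I_k -> R) :
    \sum_i (F i / residual2 P y) ^+ 2 = (\sum_i (F i) ^+ 2) / residual2 P y ^+ 2.
  by rewrite mulr_suml; apply: eq_bigr => i _; rewrite expr_div_n.
have -> : \sum_i (mult_g y i 0) ^+ 2 =
    (\sum_i (Num.max 0 (g y 0 i)) ^+ 2) / residual2 P y ^+ 2.
  by rewrite -E; apply: eq_bigr => i _; rewrite mxE.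
have -> : \sum_i (mult_h y i 0) ^+ 2 =
    (\sum_i (h y 0 i) ^+ 2) / residual2 P y ^+ 2.
  by rewrite -E; apply: eq_bigr => i _; rewrite mxE.
(* For each index one of the two squares is 0 and the other is the square of the normalised
   minimum. *)
have -> : \sum_i ((mult_G b y i 0) ^+ 2 + (mult_H b y i 0) ^+ 2) =
    (\sum_i (Num.min `|G y 0 i| `|H y 0 i|) ^+ 2) / residual2 P y ^+ 2.
  rewrite -E; apply: eq_bigr => i _; rewrite !mxE (active_branch_min i by_).
  rewrite !expr_div_n -mulrDl; congr (_ / _).
  by rewrite real_normK ?num_real//; case: ifP; rewrite expr0n/= ?addr0 ?add0r.
by rewrite -!mulrDl -/(sq_residual P y) -sqr_residual2 divff.
Qed.

Lemma mult_le1 y b : 0 < residual2 P y -> active_branch b y ->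
  [/\ forall i, `|mult_g y i 0| <= 1, forall i, `|mult_h y i 0| <= 1,
      forall i, `|mult_G b y i 0| <= 1 & forall i, `|mult_H b y i 0| <= 1].
Proof.
move=> s0 by_; have := mult_norm1 s0 by_.
set A := \sum_i _; set B := \sum_i _; set C := \sum_i _; set D := \sum_i _.
have nn k (F : 'I_k -> R) : 0 <= \sum_i (F i) ^+ 2.
  by apply: sumr_ge0 => i _; exact: sqr_ge0.
have A0 : 0 <= A := nn _ _; have B0 : 0 <= B := nn _ _.
have C0 : 0 <= C := nn _ _; have D0 : 0 <= D := nn _ _.
move=> E.
have small k (F : 'I_k -> R) i : \sum_i (F i) ^+ 2 <= 1 -> `|F i| <= 1.
  move=> F1; rewrite -(@ler_pXn2r _ 2)// ?nnegrE//.
  by rewrite real_normK ?num_real// expr1n (le_trans _ F1)// ler_sum_sqr.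
split=> i.
- by apply: (small _ (fun i => mult_g y i 0)); rewrite -/A; lra.
- by apply: (small _ (fun i => mult_h y i 0)); rewrite -/B; lra.
- by apply: (small _ (fun i => mult_G b y i 0)); rewrite -/C; lra.
- by apply: (small _ (fun i => mult_H b y i 0)); rewrite -/D; lra.
Qed.

End PenaltyMultipliers.

(** * Limits along an ultrafilter *)

Lemma add_mxE (V : nmodType) m n (A B : 'M[V]_(m, n)) i j :
  (A + B) i j = A i j + B i j.
Proof. by rewrite mxE. Qed.

Lemma sub_mxE (V : zmodType) m n (A B : 'M[V]_(m, n)) i j :
  (A - B) i j = A i j - B i j.
Proof. by rewrite !mxE. Qed.

Section UltraLimits.
Variables (R : realType) (T : Type) (U : set_system T).

(** Compactness gives a cluster point, and an ultrafilter contains each set or its complement, so a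
    cluster point is a limit. This stands in for the extraction of subsequences. *)
Lemma ultra_bounded_cvg (UU : UltraFilter U) (f : T -> R) (M : R) :
  (\forall y \near U, `|f y| <= M) -> exists a : R, f y @[y --> U] --> a.
Proof.
move=> fM; have PU := @ultra_proper _ _ UU.
have PfU : ProperFilter (f @ U) by exact: fmap_proper_filter.
have [a [_ aU]] : [set` `[- M, M]] `&` cluster (f @ U) !=set0.
  apply: (@segment_compact R (- M) M) => //.
  rewrite /nbhs /=; apply: filterS fM => y.
  by rewrite /= in_itv/= ler_norml.
exists a => B aB; have [//|UnB] := in_ultra_setVsetC (f @^-1` B) UU.
by have [y [nBy By]] := aU (~` B) B UnB aB.
Qed.

Hypothesis PU : ProperFilter U.

Lemma cvg_small_eq0 (f : T -> R) (a : R) : f y @[y --> U] --> a ->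
  (forall e : R, 0 < e -> \forall y \near U, `|f y| <= e) -> a = 0.
Proof.
move=> fa f0; apply/eqP; rewrite -normr_le0; apply/ler_addgt0Pr => e e0.
have e20 : 0 < e / 2 by lra.
have /filter_ex[y [H1 H2]] : \forall y \near U, `|a - f y| <= e / 2 /\ `|f y| <= e / 2.
  near=> y; split; near: y; last exact: f0.
  by move/cvgrPdist_le : fa; apply.
by have := ler_normD (a - f y) (f y); rewrite subrK; lra.
Unshelve. all: by end_near. Qed.

Lemma cvg_near_eq (f : T -> R) (a c : R) : f y @[y --> U] --> a ->
  (\forall y \near U, f y = c) -> a = c.
Proof.
move=> fa fc; apply/subr0_eq/(@cvg_small_eq0 (fun y => f y - c)).
  by apply: cvgB => //; exact: cvg_cst.
by move=> e e0; apply: filterS fc => y ->; rewrite subrr normr0 ltW.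
Qed.

Lemma cvg_mulmx n k (M : T -> 'M[R]_(n, k)) (l : T -> 'cV[R]_k)
    (M0 : 'M[R]_(n, k)) (l0 : 'cV[R]_k) :
  (forall i j, M y i j @[y --> U] --> M0 i j) ->
  (forall j, l y j 0 @[y --> U] --> l0 j 0) ->
  forall i, (M y *m l y) i 0 @[y --> U] --> (M0 *m l0) i 0.
Proof.
move=> HM Hl i; rewrite mxE; under eq_fun do rewrite mxE.
by apply: cvg_sumr => j; exact: cvgM.
Qed.

End UltraLimits.

(** The rows of the Jacobian are the values of the differential at the [n] basis vectors, so
    pointwise continuity at finitely many vectors yields continuity in norm. *)
Lemma jacobian_near (R : realType) n k (F : 'rV[R]_n -> 'rV[R]_k) z :
  continuously_differentiable F ->
  forall e : R, 0 < e -> \forall y \near z, `|'J F y - 'J F z| <= e.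
Proof.
move=> [_ dF] e e0.
have : \forall y \near z, forall i : 'I_n,
    `|'d F y (delta_mx 0 i) - 'd F z (delta_mx 0 i)| <= e.
  apply: (@filter_forall _ _ _ (nbhs z) (nbhs_filter z)) => i.
  by move/continuous_nearP : (dF (delta_mx 0 i) z); apply.
move=> /near_normP[d d0 H]; apply/near_normP; exists d => // y /H {}H.
apply/mx_norm_leP => [|i j]; first exact: ltW.
apply: le_trans (H i); apply: le_trans (ler_coord_norm _ 0 j).
by rewrite !mxE.
Qed.

Section LimitMultipliers.
Variables (R : realType) (n p q m : nat) (P : mpsc R n p q m).
Local Notation g := (mpsc_g P).
Local Notation h := (mpsc_h P).
Local Notation G := (mpsc_G P).
Local Notation H := (mpsc_H P).
Local Notation sdist := (dist (fun x : 'rV[R]_n => `|x|) (feasible P)).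

(** What the limit passage yields when no error bound holds; each of the two constraint
    qualifications is contradicted from these data together with smoothness and feasibility. *)
Record limit_multipliers (zs : 'rV[R]_n) (U : set_system 'rV[R]_n)
    (b : {set 'I_m}) (lg : 'cV[R]_p) (lh : 'cV[R]_q) (lG lH : 'cV[R]_m)
    (d : 'rV[R]_n) : Prop := LimitMultipliers {
  lim_filter : ProperFilter U;
  lim_near : forall e : R, 0 < e -> \forall y \near U, `|y - zs| <= e;
  lim_pos : \forall y \near U, 0 < residual2 P y;
  lim_small : forall e : R, 0 < e ->
    \forall y \near U, residual2 P y <= e * `|y - zs|;
  lim_branch : \forall y \near U, active_branch P b y;
  lim_g : forall i, mult_g P y i 0 @[y --> U] --> lg i 0;
  lim_h : forall i, mult_h P y i 0 @[y --> U] --> lh i 0;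
  lim_G : forall i, mult_G P b y i 0 @[y --> U] --> lG i 0;
  lim_H : forall i, mult_H P b y i 0 @[y --> U] --> lH i 0;
  lim_dir : (`|y - zs|^-1 *: (y - zs)) @[y --> U] --> d;
  lim_stationary : stationary_multipliers P zs lg lh lG lH;
  lim_unit : \sum_i (lg i 0) ^+ 2 + \sum_i (lh i 0) ^+ 2
    + \sum_i (lG i 0) ^+ 2 + \sum_i (lH i 0) ^+ 2 = 1 }.

Lemma limit_multipliers_exist zs : mpsc_C1 P -> feasible P zs ->
  (forall alpha : R, 0 < alpha ->
     ~ \forall z \near zs, sdist z <= alpha * residual P z) ->
  exists U b lg lh lG lH d, limit_multipliers zs U b lg lh lG lH d.
Proof.
move=> P_C1 zsF noEB.
(* The bad sets are nonempty and shrink with [e], hence form the base of a proper filter, which an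
   ultrafilter refines. *)
pose Bad (e : R) : set 'rV[R]_n := [set y | [/\ 0 < residual2 P y,
  `|y - zs| < e, residual2 P y <= e * `|y - zs| & almost_stationary P e y]].
have Bad_mono (e e' : R) : e <= e' -> Bad e `<=` Bad e'.
  move=> ee' y [y0 ye ry sy]; split => //; first exact: lt_le_trans ee'.
    by rewrite (le_trans ry)// ler_wpM2r.
  by apply: filterS sy => x; move=> /le_trans; apply; rewrite lerD2l ler_wpM2r.
pose F := filter_from [set e : R | 0 < e] Bad.
have PF : ProperFilter F.
  apply: filter_from_proper.
    apply: filter_from_filter; first by exists 1 => /=.
    move=> e e' /= e0 e'0; exists (Num.min e e') => /=; first by rewrite lt_min e0.
    by move=> y By; split; apply: Bad_mono By; rewrite ge_min lexx ?orbT.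
  move=> e /= e0.
  by have [y] := no_error_bound_almost_stationary P_C1 zsF noEB e0; exists y.
have [U [UU FU]] := ultraFilterLemma PF.
have PU := @ultra_proper _ _ UU.
have UBad (e : R) : 0 < e -> U (Bad e) by move=> e0; apply: FU; exists e.
have Upos : \forall y \near U, 0 < residual2 P y.
  by apply: filterS (UBad 1 ltr01) => y [].
(* An index left out of [b] has the complementary strict inequality along [U], so [b] is an active
   branch along [U]. *)
pose b : {set 'I_m} := [set i |
  `[< \forall y \near U, `|G y 0 i| <= `|H y 0 i| >]]%SET.
have Ub : \forall y \near U, active_branch P b y.
  apply: filter_forall => i; rewrite inE.
  case: asboolP => // Ui.
  have [//|] := in_ultra_setVsetC [set y | `|G y 0 i| <= `|H y 0 i|] UU.
  by apply: filterS => y /= /negP; rewrite -ltNge => /ltW.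
have Ule1 : \forall y \near U,
   [/\ forall i, `|mult_g P y i 0| <= 1, forall i, `|mult_h P y i 0| <= 1,
      forall i, `|mult_G P b y i 0| <= 1 & forall i, `|mult_H P b y i 0| <= 1].
  by apply: filterS2 Upos Ub => y; exact: mult_le1.
have /choice[lg Hlg] i : exists a : R, mult_g P y i 0 @[y --> U] --> a.
  by apply: (@ultra_bounded_cvg _ _ _ UU _ 1); apply: filterS Ule1 => y [].
have /choice[lh Hlh] i : exists a : R, mult_h P y i 0 @[y --> U] --> a.
  by apply: (@ultra_bounded_cvg _ _ _ UU _ 1); apply: filterS Ule1 => y [].
have /choice[lG HlG] i : exists a : R, mult_G P b y i 0 @[y --> U] --> a.
  by apply: (@ultra_bounded_cvg _ _ _ UU _ 1); apply: filterS Ule1 => y [].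
have /choice[lH HlH] i : exists a : R, mult_H P b y i 0 @[y --> U] --> a.
  by apply: (@ultra_bounded_cvg _ _ _ UU _ 1); apply: filterS Ule1 => y [].
have /choice[d Hd] i : exists a : R,
    (`|y - zs|^-1 *: (y - zs)) 0 i @[y --> U] --> a.
  apply: (@ultra_bounded_cvg _ _ _ UU _ 1); near=> y.
  rewrite (le_trans (ler_coord_norm _ _ _))// normrZ normfV normr_id.
  by have [->|y0] := eqVneq `|y - zs| 0; rewrite ?mulr0// mulVf.
have Unear (e : R) : 0 < e -> \forall y \near U, `|y - zs| <= e.
  by move=> e0; apply: filterS (UBad e e0) => y [_ /ltW].
have UzsP (Q : set 'rV[R]_n) : (\forall y \near zs, Q y) -> \forall y \near U, Q y.
  move=> /near_normP[r r0 Hr]; have r20 : 0 < r / 2 by lra.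
  by apply: filterS (Unear _ r20) => y yr; apply: Hr; lra.
have UJ k (K : 'rV[R]_n -> 'rV[R]_k) i j : continuously_differentiable K ->
    'J K y i j @[y --> U] --> 'J K zs i j.
  move=> K1; apply/cvgrPdist_le => e e0.
  apply: filterS (UzsP _ (jacobian_near zs K1 e0)) => y.
  move: ('J K y) ('J K zs) => A B AB.
  by rewrite distrC (le_trans _ AB)// -sub_mxE ler_coord_norm.
exists U, b, (\col_i lg i), (\col_i lh i), (\col_i lG i), (\col_i lH i), (\row_i d i).
have Hlg' i : mult_g P y i 0 @[y --> U] --> (\col_i lg i) i 0 by rewrite mxE.
have Hlh' i : mult_h P y i 0 @[y --> U] --> (\col_i lh i) i 0 by rewrite mxE.
have HlG' i : mult_G P b y i 0 @[y --> U] --> (\col_i lG i) i 0 by rewrite mxE.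
have HlH' i : mult_H P b y i 0 @[y --> U] --> (\col_i lH i) i 0 by rewrite mxE.
split => //.
- by move=> e e0; apply: filterS (UBad e e0) => y [].
- by apply: cvg_mxP => i j; rewrite ord1 mxE; exact: Hd.
- case: (P_C1) => _ Cg Ch CG CH.
  rewrite /stationary_multipliers; apply/esym/colP => k; rewrite [RHS]mxE.
  pose w y := 'J g y *m mult_g P y + 'J h y *m mult_h P y
             + 'J G y *m mult_G P b y + 'J H y *m mult_H P b y.
  apply: (@cvg_small_eq0 _ _ U PU (fun y => w y k 0)).
    rewrite /w !add_mxE; under eq_fun do rewrite !add_mxE.
    by apply: cvgD; [apply: cvgD; [apply: cvgD|]|];
      apply: cvg_mulmx => // i j; exact: UJ.
  move=> e e0; have := UBad e e0; apply: filterS2 Ub => y by_ [y0 _ _ sy].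
  (* Testing with the k-th basis row isolates the k-th coordinate of the stationarity defect. *)
  have : `|((delta_mx 0 k : 'rV[R]_n) *m w y) 0 0| <=
      e * `|delta_mx 0 k : 'rV[R]_n|.
    exact: (almost_stationary_multipliers P_C1 e0 y0 sy by_ (delta_mx 0 k)).
  move: (w y) => wy; rewrite -(rowE k wy) mxE => /le_trans; apply.
  rewrite ler_piMr//; first exact: ltW.
  apply/mx_norm_leP => // i j; rewrite mxE.
  by case: (_ && _); rewrite ?normr1 ?normr0.
- have Hsum : (\sum_i (mult_g P y i 0) ^+ 2 + \sum_i (mult_h P y i 0) ^+ 2
    + \sum_i (mult_G P b y i 0) ^+ 2 + \sum_i (mult_H P b y i 0) ^+ 2) @[y --> U] -->
    (\sum_i ((\col_i lg i) i 0) ^+ 2 + \sum_i ((\col_i lh i) i 0) ^+ 2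
    + \sum_i ((\col_i lG i) i 0) ^+ 2 + \sum_i ((\col_i lH i) i 0) ^+ 2).
    by apply: cvgD; [apply: cvgD; [apply: cvgD|]|];
      apply: cvg_sumr => i; apply: cvg_sqr.
  apply: (cvg_near_eq PU Hsum); apply: filterS2 Upos Ub => y; exact: mult_norm1.
Unshelve. all: by end_near. Qed.

End LimitMultipliers.

(** * Directional quasi-normality *)

Section FilterOrder.
Variables (R : realType) (T : Type) (U : set_system T) (PU : ProperFilter U).

Lemma cvg_near_le (f : T -> R) (a c : R) : f y @[y --> U] --> a ->
  (\forall y \near U, f y <= c) -> a <= c.
Proof.
move=> fa fc; rewrite leNgt; apply/negP => ca.
have fc' : \forall y \near U, c < f y by exact: (cvgr_gt _ fa).
have [y [H1]] : exists y, c < f y /\ f y <= c.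
  by apply: (@filter_ex _ U); apply: filterS2 fc' fc.
by rewrite leNgt H1.
Qed.

Lemma cvg_near_ge (f : T -> R) (a c : R) : f y @[y --> U] --> a ->
  (\forall y \near U, c <= f y) -> c <= a.
Proof.
move=> fa fc; rewrite leNgt; apply/negP => ca.
have fc' : \forall y \near U, f y < c by exact: (cvgr_lt _ fa).
have [y [H1]] : exists y, f y < c /\ c <= f y.
  by apply: (@filter_ex _ U); apply: filterS2 fc' fc.
by rewrite leNgt H1.
Qed.

Lemma cvg_near_mul_gt0 (f : T -> R) (a : R) : f y @[y --> U] --> a -> a != 0 ->
  \forall y \near U, 0 < a * f y.
Proof.
move=> fa a0; apply: (cvgr_gt (a * a)); last by rewrite -expr2 exprn_even_gt0.
by apply: cvgM => //; exact: cvg_cst.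
Qed.

Lemma near_wlog_neq0 (k : nat) (l : 'cV[R]_k) (Q : 'I_k -> T -> Prop) :
  (forall i, l i 0 != 0 -> \forall y \near U, Q i y) ->
  \forall y \near U, forall i, l i 0 != 0 -> Q i y.
Proof.
move=> HQ; apply: filter_forall => i; have [i0|i0] := eqVneq (l i 0) 0.
  by near=> y.
by apply: filterS (HQ i i0) => y.
Unshelve. all: by end_near. Qed.

Variables (n : nat) (zs d : 'rV[R]_n) (x : T -> 'rV[R]_n).
Hypothesis x_near : forall e : R, 0 < e -> \forall y \near U, `|x y - zs| <= e.

Lemma near_filter_of_nbhs (Q : set 'rV[R]_n) : (\forall y \near zs, Q y) ->
  \forall y \near U, Q (x y).
Proof.
move=> /near_normP[r r0 Hr]; have r20 : 0 < r / 2 by lra.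
by apply: filterS (x_near r20) => y yr; apply: Hr; lra.
Qed.

Lemma cvg_of_has_grad (f : 'rV[R]_n -> R) a : has_grad f zs a ->
  f (x y) @[y --> U] --> f zs.
Proof.
move=> /has_grad_near_shift fs; apply/cvgrPdist_lt => e e0.
by apply: filterS (near_filter_of_nbhs (fs e e0)) => y; rewrite distrC.
Qed.

Hypothesis x_dir : (`|x y - zs|^-1 *: (x y - zs)) @[y --> U] --> d.

(** As [f zs = 0], the quotient is the slope along the normalised displacement plus a remainder that
    tends to 0. *)
Lemma directional_quotient_cvg (f : 'rV[R]_n -> R) a : has_grad f zs a ->
  f zs = 0 -> f (x y) / `|x y - zs| @[y --> U] --> (d *m a) 0 0.
Proof.
move=> fa f0.
pose u y := ((`|x y - zs|^-1 *: (x y - zs)) *m a) 0 0.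
have ucvg : u y @[y --> U] --> (d *m a) 0 0.
  rewrite /u mxE; under eq_fun do rewrite mxE.
  apply: cvg_sumr => i; apply: cvgM; last exact: cvg_cst.
  apply/cvgrPdist_le => e e0; move/cvgrPdist_le : x_dir => /(_ e e0).
  apply: filterS => y; apply: le_trans.
  by rewrite -sub_mxE ler_coord_norm.
have rcvg : (f (x y) / `|x y - zs| - u y) @[y --> U] --> (0 : R).
  apply/cvgrPdist_le => e e0; rewrite /u.
  apply: filterS (near_filter_of_nbhs (fa e e0)) => y.
  rewrite f0 subr0 => fe.
  rewrite sub0r normrN -scalemxAl [X in _ - X]mxE (mulrC (f _)) -mulrBr.
  rewrite normrM normfV normr_id.
  (* At [x y = zs] the inverse of 0 is 0 and the bound is trivial. *)
  have [t0|t0] := eqVneq `|x y - zs| 0; first by rewrite t0 invr0 mul0r ltW.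
  by rewrite ler_pdivrMl 1?mulrC// lt_neqAle eq_sym t0 normr_ge0.
rewrite -[X in _ --> X]add0r.
have -> : (fun y => f (x y) / `|x y - zs|) =
  (fun y => (f (x y) / `|x y - zs| - u y) + u y).
  by apply/funext => y; rewrite subrK.
exact: cvgD.
Qed.

End FilterOrder.

(** * Signs and slopes of the limit multipliers and the limit direction *)

Section LimitConsequences.
Variables (R : realType) (n p q m : nat) (P : mpsc R n p q m).
Local Notation g := (mpsc_g P).
Local Notation h := (mpsc_h P).
Local Notation G := (mpsc_G P).
Local Notation H := (mpsc_H P).
Variables (zs : 'rV[R]_n) (U : set_system 'rV[R]_n) (b : {set 'I_m})
  (lg : 'cV[R]_p) (lh : 'cV[R]_q) (lG lH : 'cV[R]_m) (d : 'rV[R]_n).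
Hypotheses (P_C1 : mpsc_C1 P) (zsF : feasible P zs)
  (HL : limit_multipliers P zs U b lg lh lG lH d).

#[local] Instance PU : ProperFilter U := lim_filter HL.

Let quotient_cvg := directional_quotient_cvg PU (lim_near HL) (lim_dir HL).

Lemma lim_pos_dist : \forall y \near U, 0 < `|y - zs|.
Proof.
apply: filterS2 (lim_pos HL) (lim_small HL ltr01) => y y0 /(lt_le_trans y0).
by rewrite mul1r.
Qed.

Lemma quotient_le (f : 'rV[R]_n -> R) (e : R) : 0 < e ->
  (\forall y \near U, f y <= residual2 P y) ->
  \forall y \near U, f y / `|y - zs| <= e.
Proof.
move=> e0 fr; near=> y.
have y0 : 0 < `|y - zs| by near: y; exact: lim_pos_dist.
rewrite ler_pdivrMr// (@le_trans _ _ (residual2 P y))//; first by near: y.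
by near: y; exact: (lim_small HL).
Unshelve. all: by end_near. Qed.

(** By [lim_small] the residual is of smaller order than [|y - zs|], and so is any function it
    dominates. *)
Lemma residual_slope_eq0 (f : 'rV[R]_n -> R) a : has_grad f zs a -> f zs = 0 ->
  (\forall y \near U, `|f y| <= residual2 P y) -> (d *m a) 0 0 = 0.
Proof.
move=> fa f0 fr; apply: (cvg_small_eq0 PU (quotient_cvg fa f0)) => e e0.
have := quotient_le e0 fr; apply: filterS => y.
by rewrite normrM normfV normr_id.
Qed.

Lemma residual_g_le y i : g y 0 i <= residual2 P y.
Proof. by rewrite (le_trans _ (residual2_g P y i))// le_max lexx orbT. Qed.

Lemma residual_G_le i : i \in b -> \forall y \near U, `|G y 0 i| <= residual2 P y.
Proof.
move=> ib; apply: filterS (lim_branch HL) => y /active_branch_min -/(_ i).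
by rewrite ib => <-; exact: residual2_GH.
Qed.

Lemma residual_H_le i : i \notin b ->
  \forall y \near U, `|H y 0 i| <= residual2 P y.
Proof.
move=> ib; apply: filterS (lim_branch HL) => y /active_branch_min -/(_ i).
by rewrite (negbTE ib) => <-; exact: residual2_GH.
Qed.

Lemma residual2_near0 (f : 'rV[R]_n -> R) :
  (\forall y \near U, `|f y| <= residual2 P y) ->
  forall e : R, 0 < e -> \forall y \near U, `|f y| <= e.
Proof.
move=> fr e e0; near=> y.
have H1 : `|f y| <= residual2 P y by near: y.
have H2 : residual2 P y <= 1 * `|y - zs| by near: y; exact: (lim_small HL).
have H3 : `|y - zs| <= e by near: y; exact: (lim_near HL).
by lra.
Unshelve. all: by end_near. Qed.

(** Outside [b] the value of [H_i] is dominated by the residual, so it would tend to 0 and not to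
    the nonzero [H zs 0 i]. *)
Lemma IG_branch i : i \in IG P zs -> i \in b.
Proof.
rewrite inE => /andP[_ H0]; apply/negPn/negP => ib; move/eqP : H0; apply.
have cH := cvg_of_has_grad PU (lim_near HL) (has_grad_H P_C1 zs i).
exact: (cvg_small_eq0 PU cH (residual2_near0 (residual_H_le ib))).
Qed.

Lemma IH_branch i : i \in IH P zs -> i \notin b.
Proof.
rewrite inE => /andP[G0 _]; apply/negP => ib; move/eqP : G0; apply.
have cG := cvg_of_has_grad PU (lim_near HL) (has_grad_G P_C1 zs i).
exact: (cvg_small_eq0 PU cG (residual2_near0 (residual_G_le ib))).
Qed.

Lemma slope_G_eq0 i : i \in b -> G zs 0 i = 0 -> slope G i zs d = 0.
Proof.
move=> ib G0.
exact: (residual_slope_eq0 (has_grad_G P_C1 zs i) G0 (residual_G_le ib)).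
Qed.

Lemma slope_H_eq0 i : i \notin b -> H zs 0 i = 0 -> slope H i zs d = 0.
Proof.
move=> ib H0.
exact: (residual_slope_eq0 (has_grad_H P_C1 zs i) H0 (residual_H_le ib)).
Qed.

Lemma lim_dir_lin_cone : lin_cone P zs d.
Proof.
split=> i.
- rewrite inE => /eqP g0; apply/ler_addgt0Pr => e e0; rewrite add0r.
  apply: (cvg_near_le PU (quotient_cvg (has_grad_g P_C1 zs i) g0)).
  by apply: quotient_le => //; near=> y; exact: residual_g_le.
- case: zsF => _ /(_ i) h0 _.
  apply: (residual_slope_eq0 (has_grad_h P_C1 zs i) h0).
  by near=> y; exact: residual2_h.
- move=> iG; apply: slope_G_eq0; first exact: IG_branch.
  by move: iG; rewrite inE => /andP[/eqP].
- move=> iH; apply: slope_H_eq0; first exact: IH_branch.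
  by move: iH; rewrite inE => /andP[_ /eqP].
- rewrite inE => /andP[/eqP G0 /eqP H0]; have [ib|ib] := boolP (i \in b).
    by rewrite slope_G_eq0// mul0r.
  by rewrite slope_H_eq0// mulr0.
Unshelve. all: by end_near. Qed.

Lemma lim_g_ge0 i : 0 <= lg i 0.
Proof.
apply: (cvg_near_ge PU (lim_g HL (i:=i))).
by near=> y; rewrite mxE divr_ge0 ?residual2_ge0// max0_ge0.
Unshelve. all: by end_near. Qed.

Lemma lim_g_eq0 i : (\forall y \near U, g y 0 i <= 0) -> lg i 0 = 0.
Proof.
move=> g0; apply: (cvg_near_eq PU (lim_g HL (i:=i))); apply: filterS g0 => y g0.
by rewrite mxE max_l// mul0r.
Qed.

Lemma lim_g_inactive i : g zs 0 i != 0 -> lg i 0 = 0.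
Proof.
move=> g0; have gn : g zs 0 i < 0.
  by rewrite lt_neqAle g0; case: zsF => /(_ i).
apply: lim_g_eq0.
have cg := cvg_of_has_grad PU (lim_near HL) (has_grad_g P_C1 zs i).
by apply: filterS (cvgr_lt _ cg _ gn) => y /ltW.
Qed.

Lemma lim_H_eq0 i : i \in b -> lH i 0 = 0.
Proof.
move=> ib; apply: (cvg_near_eq PU (lim_H HL (i:=i))).
by near=> y; rewrite mxE ib mul0r.
Unshelve. all: by end_near. Qed.

Lemma lim_G_eq0 i : i \notin b -> lG i 0 = 0.
Proof.
move=> ib; apply: (cvg_near_eq PU (lim_G HL (i:=i))).
by near=> y; rewrite mxE (negbTE ib) mul0r.
Unshelve. all: by end_near. Qed.

Lemma lim_neq0 : (lg, lh, lG, lH) <> 0.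
Proof.
move=> E; have [Eg Eh EG EH] : [/\ lg = 0, lh = 0, lG = 0 & lH = 0].
  by case: E => -> -> -> ->.
have := lim_unit HL; rewrite Eg Eh EG EH.
have z k : \sum_(i < k) ((0 : 'cV[R]_k) i 0) ^+ 2 = 0.
  by apply: big1 => i _; rewrite mxE expr0n.
by rewrite !z !addr0 => /esym/eqP; rewrite oner_eq0.
Qed.

Lemma lim_sign_conditions : sign_conditions P zs d lg lG lH.
Proof.
(* A biactive index outside [b] has zero slope of [H_i] along [d], which excludes it from [IGd]; the
   case of [IHd] is symmetric. *)
have inb_IGd i : i \in (IG P zs :|: IGd P zs d)%SET -> i \in b.
  rewrite inE => /orP[/IG_branch//|]; rewrite !inE => /andP[/andP[_ H0]].
  by move=> /andP[_]; apply: contraR => /slope_H_eq0 -> //; exact/eqP.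
have inb_IHd i : i \in (IH P zs :|: IHd P zs d)%SET -> i \notin b.
  rewrite inE => /orP[/IH_branch//|]; rewrite !inE => /andP[/andP[G0 _]].
  by move=> /andP[+ _]; apply: contra => /slope_G_eq0 -> //; exact/eqP.
split=> i.
- by move=> _; exact: lim_g_ge0.
- rewrite !inE negb_and => /orP[/lim_g_inactive//|].
  have [/eqP g0|g0 _] := boolP (g zs 0 i == 0); last exact: lim_g_inactive.
  move=> s0; have [sg _ _ _ _] := lim_dir_lin_cone.
  have sn : slope g i zs d < 0 by rewrite lt_neqAle s0 sg// inE g0 eqxx.
  apply: lim_g_eq0.
  (* The quotient converges to a negative slope, so [g_i] is negative along [U] and its multiplier
     vanishes. *)
  have qn : \forall y \near U, g y 0 i / `|y - zs| < 0.
    exact: (cvgr_lt _ (quotient_cvg (has_grad_g P_C1 zs i) g0)).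
  apply: filterS2 lim_pos_dist qn => y y0.
  by rewrite pmulr_llt0 ?invr_gt0// => /ltW.
- by move=> /inb_IGd; exact: lim_H_eq0.
- by move=> /inb_IHd; exact: lim_G_eq0.
- move=> _; have [ib|ib] := boolP (i \in b).
    by rewrite lim_H_eq0// mulr0.
  by rewrite lim_G_eq0// mul0r.
Qed.

(** Each multiplier before the limit is 0 or a positive multiple of the constraint value, and a
    nonzero limit forces the second case with the sign of the limit. *)
Lemma lim_mult_sign : \forall y \near U,
  [/\ forall i, lg i 0 != 0 -> 0 < lg i 0 * g y 0 i,
      forall j, lh j 0 != 0 -> 0 < lh j 0 * h y 0 j,
      forall i, lG i 0 != 0 -> 0 < lG i 0 * G y 0 i
    & forall i, lH i 0 != 0 -> 0 < lH i 0 * H y 0 i].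
Proof.
have Ng := near_wlog_neq0 PU (fun i => cvg_near_mul_gt0 PU (lim_g HL (i:=i))).
have Nh := near_wlog_neq0 PU (fun i => cvg_near_mul_gt0 PU (lim_h HL (i:=i))).
have NG := near_wlog_neq0 PU (fun i => cvg_near_mul_gt0 PU (lim_G HL (i:=i))).
have NH := near_wlog_neq0 PU (fun i => cvg_near_mul_gt0 PU (lim_H HL (i:=i))).
near=> y.
have y0 : 0 < residual2 P y by near: y; exact: (lim_pos HL).
split=> i l0.
- have : 0 < lg i 0 * mult_g P y i 0 by move: i l0; near: y.
  rewrite mxE mulrA pmulr_lgt0 ?invr_gt0//.
  by case: (leP 0 (g y 0 i)) => // _; rewrite mulr0 ltxx.
- have : 0 < lh i 0 * mult_h P y i 0 by move: i l0; near: y.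
  by rewrite mxE mulrA pmulr_lgt0 ?invr_gt0.
- have : 0 < lG i 0 * mult_G P b y i 0 by move: i l0; near: y.
  rewrite mxE mulrA pmulr_lgt0 ?invr_gt0//.
  by case: ifP => // _; rewrite mulr0 ltxx.
- have : 0 < lH i 0 * mult_H P b y i 0 by move: i l0; near: y.
  rewrite mxE mulrA pmulr_lgt0 ?invr_gt0//.
  by case: ifP => // _; rewrite mulr0 ltxx.
Unshelve. all: by end_near. Qed.

(** Sets of the filter are nonempty, so a point [y k] of accuracy [1 / (k + 1)] can be picked in
    each. Step length [|y k - zs|] and the normalised displacement reproduce [y k] exactly. *)
Lemma lim_sequential_conditions : sequential_conditions P zs d lg lh lG lH.
Proof.
have /choice[y Hy] : forall k : nat, exists y : 'rV[R]_n,
  [/\ 0 < `|y - zs|, `|y - zs| <= k.+1%:R^-1,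
   `|d - `|y - zs|^-1 *: (y - zs)| <= k.+1%:R^-1 &
   [/\ forall i, lg i 0 != 0 -> 0 < lg i 0 * g y 0 i,
      forall j, lh j 0 != 0 -> 0 < lh j 0 * h y 0 j,
      forall i, lG i 0 != 0 -> 0 < lG i 0 * G y 0 i
    & forall i, lH i 0 != 0 -> 0 < lH i 0 * H y 0 i]].
  move=> k; have k0 : 0 < k.+1%:R^-1 :> R by rewrite invr_gt0.
  apply: (@filter_ex _ U); near=> y; split; near: y.
  - exact: lim_pos_dist.
  - exact: (lim_near HL).
  - by move/cvgrPdist_le : (lim_dir HL); apply.
  - exact: lim_mult_sign.
have inv_small (e : R) : 0 < e -> \forall k \near \oo, k.+1%:R^-1 <= e.
  move=> e0; near=> k; rewrite invf_ple ?posrE// (le_trans (ltW (truncnS_gt _)))//.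
  by rewrite ler_nat ltnS; near: k; exact: nbhs_infty_ge.
exists (fun k => `|y k - zs|^-1 *: (y k - zs)), (fun k => `|y k - zs|); split.
- apply/cvgrPdist_le => e e0; apply: filterS (inv_small e e0) => k ke.
  by apply: le_trans ke; case: (Hy k).
- by move=> k; case: (Hy k).
- apply/cvgrPdist_le => e e0; apply: filterS (inv_small e e0) => k ke.
  by rewrite sub0r normrN normr_id; apply: le_trans ke; case: (Hy k).
- move=> k; case: (Hy k) => y0 _ _ Hk; rewrite /=.
  by rewrite scalerA mulfV ?gt_eqF// scale1r addrC subrK.
Unshelve. all: by end_near. Qed.

Lemma quasi_normality_contra : ~ directional_quasi_normality P zs.
Proof.
move=> /(_ d lim_dir_lin_cone); apply; exists lg, lh, lG, lH; split.
- exact: lim_neq0.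
- exact: (lim_stationary HL).
- exact: lim_sign_conditions.
- exact: lim_sequential_conditions.
Qed.

End LimitConsequences.

(** * Piecewise CRSC *)

Section SubFamilies.
Variable R : realType.

Lemma mul_colsub_rowsub m n k (B : {set 'I_n}) (A : 'M[R]_(m, n))
    (l : 'M[R]_(n, k)) : (forall i, i \notin B -> row i l = 0) ->
  colsub (fun i : 'I_#|B| => enum_val i) A *m
    rowsub (fun i : 'I_#|B| => enum_val i) l = A *m l.
Proof.
move=> l0; apply/matrixP => i j; rewrite !mxE.
under eq_bigr do rewrite !mxE.
rewrite -(big_enum_val (fun x => A i x * l x j)) /= [RHS](bigID (mem B)) /=.
rewrite [X in _ + X]big1 ?addr0// => x /l0 /rowP/(_ j).
by rewrite !mxE => ->; rewrite mulr0.
Qed.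

Lemma has_grad_row_mx n k1 k2 (F : 'rV[R]_n -> 'rV[R]_k1)
    (K : 'rV[R]_n -> 'rV[R]_k2) z (A : 'M[R]_(n, k1)) (B : 'M[R]_(n, k2)) :
  (forall i, has_grad (fun y => F y 0 i) z (col i A)) ->
  (forall i, has_grad (fun y => K y 0 i) z (col i B)) ->
  forall i, has_grad (fun y => row_mx (F y) (K y) 0 i) z (col i (row_mx A B)).
Proof.
move=> HF HK i; case: (split_ordP i) => j ->.
  by rewrite colKl; under eq_fun do rewrite row_mxEl; exact: HF.
by rewrite colKr; under eq_fun do rewrite row_mxEr; exact: HK.
Qed.

Lemma has_grad_subrow n k (F : 'rV[R]_n -> 'rV[R]_k) z (A : 'M[R]_(n, k))
    (B : {set 'I_k}) :
  (forall i, has_grad (fun y => F y 0 i) z (col i A)) ->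
  forall j : 'I_#|B|, has_grad (fun y => subrow B (F y) 0 j) z
    (col j (colsub (fun i : 'I_#|B| => enum_val i) A)).
Proof.
move=> HF j; under eq_fun do rewrite mxE.
have -> : col j (colsub (fun i : 'I_#|B| => enum_val i) A) = col (enum_val j) A.
  by apply/colP => i; rewrite !mxE.
exact: HF.
Qed.

Lemma subrow_colsub k (B : {set 'I_k}) (v : 'rV[R]_k) :
  subrow B v = colsub (fun i : 'I_#|B| => enum_val i) v.
Proof. by apply/rowP => i; rewrite !mxE. Qed.

Lemma norm_row_mx_le m k1 k2 (A : 'M[R]_(m, k1)) (B : 'M[R]_(m, k2)) (e : R) :
  0 <= e -> `|A| <= e -> `|B| <= e -> `|row_mx A B| <= e.
Proof.
move=> e0 /(mx_norm_leP _ e0) Ae /(mx_norm_leP _ e0) Be.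
apply/(mx_norm_leP _ e0) => i j; case: (split_ordP j) => l ->.
  by rewrite row_mxEl.
by rewrite row_mxEr.
Qed.

Lemma norm_colsub_le m k1 k2 (A : 'M[R]_(m, k1)) (f : 'I_k2 -> 'I_k1) :
  `|colsub f A| <= `|A|.
Proof. by apply/mx_norm_leP => // i j; rewrite mxE ler_coord_norm. Qed.

Definition near_continuous_mx n k l (D : 'rV[R]_n -> 'M[R]_(k, l)) z : Prop :=
  forall e : R, 0 < e -> \forall y \near z, `|D y - D z| <= e.

Lemma near_continuous_row_mx n k l1 l2 (D : 'rV[R]_n -> 'M[R]_(k, l1))
    (E : 'rV[R]_n -> 'M[R]_(k, l2)) z :
  near_continuous_mx D z -> near_continuous_mx E z ->
  near_continuous_mx (fun y => row_mx (D y) (E y)) z.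
Proof.
move=> HD HE e e0; apply: filterS2 (HD e e0) (HE e e0) => y De Ee.
by rewrite opp_row_mx add_row_mx norm_row_mx_le// ltW.
Qed.

Lemma near_continuous_colsub n k l1 l2 (D : 'rV[R]_n -> 'M[R]_(k, l1))
    (f : 'I_l2 -> 'I_l1) z :
  near_continuous_mx D z -> near_continuous_mx (fun y => colsub f (D y)) z.
Proof.
move=> HD e e0; apply: filterS (HD e e0) => y; apply: le_trans.
by rewrite -linearB norm_colsub_le.
Qed.

Lemma gradE n k (F : 'rV[R]_n -> 'rV[R]_k) i z l : grad F i z l 0 = 'J F z l i.
Proof. by rewrite /grad; move: ('J F z) => A; rewrite mxE. Qed.

(** Scaling by the coefficient of [l] passes between the defining relation and a homogeneous one
    with positive weight at [l]. In homogeneous form a single relation certifies every index of its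
    support. *)
Lemma nlp_IminusP n p q (P : nlp R n p q) z l :
  reflect (exists (mu : 'cV[R]_p) (lam : 'cV[R]_q),
    [/\ forall i, 0 <= mu i 0, forall i, nlp_g P z 0 i != 0 -> mu i 0 = 0,
        0 < mu l 0 & 'J (nlp_g P) z *m mu + 'J (nlp_h P) z *m lam = 0])
    (l \in nlp_Iminus P z).
Proof.
apply: (iffP idP).
  rewrite !inE => /andP[/eqP l0] /asboolP[lam [mu [mu0 E]]].
  pose mu' : 'cV[R]_p := \col_i (if i == l then 1 else
    if nlp_g P z 0 i == 0 then mu i else 0).
  exists mu', (\col_j lam j); split.
  - by move=> i; rewrite mxE; case: ifP => // _; case: ifP.
  - move=> i i0; rewrite mxE (negbTE i0); case: eqP => // il.
    by rewrite il l0 eqxx in i0.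
  - by rewrite mxE eqxx.
  - rewrite 2!mulmx_sum_col (bigD1 l)//= -!/(grad _ _ _) mxE eqxx scale1r.
    rewrite -addrA -(opprK (grad (nlp_g P) l z)) E addrC; apply/eqP.
    rewrite subr_eq0; apply/eqP; rewrite addrC; congr (_ + _).
      by apply: eq_bigr => j _; rewrite mxE.
    rewrite big_mkcond [RHS]big_mkcond; apply: eq_bigr => i _.
    rewrite !inE mxE; case: eqP => //= _; case: ifP => // _; exact: scale0r.
move=> [mu [lam [mu0 muI mul E]]].
have l0 : nlp_g P z 0 l == 0.
  by apply: contraTT mul => /muI ->; rewrite ltxx.
rewrite !inE l0 /=; apply/asboolP.
exists (fun j => lam j 0 / mu l 0), (fun i => mu i 0 / mu l 0); split.
  by move=> i; rewrite divr_ge0.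
have E2 : mu l 0 *: grad (nlp_g P) l z
  + \sum_(i in (nlp_active P z :\ l)%SET) mu i 0 *: grad (nlp_g P) i z
  + \sum_j lam j 0 *: grad (nlp_h P) j z = 0.
  rewrite -[RHS]E 2!mulmx_sum_col [in RHS](bigD1 l)//=; congr (_ + _ + _).
  rewrite big_mkcond [RHS]big_mkcond; apply: eq_bigr => i _.
  rewrite !inE; case: eqP => //= _; case: eqP => // /eqP /muI ->.
  by rewrite scale0r.
apply: (@scalerI _ _ (mu l 0)); first by rewrite gt_eqF.
rewrite scalerN scalerDr !scaler_sumr.
under eq_bigr do rewrite scalerA mulrCA divff ?gt_eqF// mulr1.
under [X in _ = _ + X]eq_bigr do rewrite scalerA mulrCA divff ?gt_eqF// mulr1.
apply/eqP; rewrite eq_sym -addr_eq0 addrC addrA; apply/eqP.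
by rewrite -addrA [X in _ + X]addrC addrA.
Qed.

End SubFamilies.

(** * The branch selected by the ultrafilter *)

Section PiecewiseCRSC.
Variables (R : realType) (n p q m : nat) (P : mpsc R n p q m).
Local Notation g := (mpsc_g P).
Local Notation h := (mpsc_h P).
Local Notation G := (mpsc_G P).
Local Notation H := (mpsc_H P).
Variables (zs : 'rV[R]_n) (U : set_system 'rV[R]_n) (b : {set 'I_m})
  (lg : 'cV[R]_p) (lh : 'cV[R]_q) (lG lH : 'cV[R]_m) (d : 'rV[R]_n).
Hypotheses (P_C1 : mpsc_C1 P) (zsF : feasible P zs)
  (HL : limit_multipliers P zs U b lg lh lG lH d).

#[local] Instance PU' : ProperFilter U := lim_filter HL.

(** The partition of the biactive indices induced by [b]; by [in_B1] and [in_B2] the branch program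
    then imposes [G_i = 0] exactly on [b] and [H_i = 0] exactly off [b]. *)
Let b1 := (IGH P zs :&: b)%SET.
Let b2 := (IGH P zs :\: b)%SET.
Let B1 := (IG P zs :|: b1)%SET.
Let B2 := (IH P zs :|: b2)%SET.
Let NL := nlp_branch P zs b1 b2.
Let hb := nlp_h NL.
Let ev k (B : {set 'I_k}) (i : 'I_#|B|) : 'I_k := enum_val i.

Lemma zs_cases i : [|| i \in IG P zs, i \in IH P zs | i \in IGH P zs].
Proof.
case: zsF => _ _ /(_ i)/eqP; rewrite mulf_eq0 !inE.
by case: (G zs 0 i == 0); case: (H zs 0 i == 0).
Qed.

Lemma in_B1 i : (i \in B1) = (i \in b).
Proof.
apply/idP/idP; first by rewrite !inE => /orP[|/andP[_ //]] iG;
  apply: (IG_branch P_C1 HL); rewrite inE.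
move=> ib; rewrite /B1 /b1 finset.in_setU finset.in_setI ib andbT.
case/or3P : (zs_cases i) => [->//|iH|->]; last by rewrite orbT.
by have := IH_branch P_C1 HL iH; rewrite ib.
Qed.

Lemma in_B2 i : (i \in B2) = (i \notin b).
Proof.
apply/idP/idP.
  rewrite /B2 /b2 finset.in_setU finset.in_setD.
  move=> /orP[/(IH_branch P_C1 HL)//|/andP[]//].
move=> ib; rewrite /B2 /b2 finset.in_setU finset.in_setD ib /=.
case/or3P : (zs_cases i) => [iG|->//|->]; last by rewrite orbT.
by have := IG_branch P_C1 HL iG; rewrite (negbTE ib).
Qed.

Lemma G_zs_B1 i : i \in B1 -> G zs 0 i = 0.
Proof. by rewrite !inE => /orP[/andP[/eqP]|/andP[/andP[/eqP]]]. Qed.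

Lemma H_zs_B2 i : i \in B2 -> H zs 0 i = 0.
Proof. by rewrite !inE => /orP[/andP[_ /eqP]|/andP[_ /andP[_ /eqP]]]. Qed.

Let Dhb z := row_mx ('J h z)
  (row_mx (colsub (@ev m B1) ('J G z)) (colsub (@ev m B2) ('J H z))).

Lemma has_grad_hb z i : has_grad (fun y => hb y 0 i) z (col i (Dhb z)).
Proof.
apply: has_grad_row_mx => [j|j]; first exact: has_grad_h.
by apply: has_grad_row_mx => l; apply: has_grad_subrow => k;
  [exact: has_grad_G|exact: has_grad_H].
Qed.

Lemma jacobian_hb z : 'J hb z = Dhb z.
Proof. by apply: has_grad_jacobian => i; exact: has_grad_hb. Qed.

Let I := nlp_Iminus NL zs.
Let Phi y := row_mx (subrow I (g y)) (hb y).
Let DPhi y := row_mx (colsub (@ev p I) ('J g y)) (Dhb y).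

Lemma has_grad_Phi z i : has_grad (fun y => Phi y 0 i) z (col i (DPhi z)).
Proof.
apply: has_grad_row_mx => j; last exact: has_grad_hb.
by apply: has_grad_subrow => k; exact: has_grad_g.
Qed.

Lemma rank_DPhi y : nlp_grad_rank NL I y = \rank (DPhi y).
Proof.
rewrite /nlp_grad_rank -/hb jacobian_hb; congr (\rank (row_mx _ _)).
apply/matrixP => k i; rewrite mxE gradE.
by rewrite /NL /=; move: ('J g y) => A; rewrite mxE.
Qed.

Lemma near_continuous_DPhi : near_continuous_mx DPhi zs.
Proof.
case: P_C1 => _ Cg Ch CG CH.
apply: near_continuous_row_mx.
  by apply: near_continuous_colsub => e; exact: jacobian_near.
apply: near_continuous_row_mx; first by move=> e; exact: jacobian_near.
by apply: near_continuous_row_mx; apply: near_continuous_colsub => e;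
  exact: jacobian_near.
Qed.

Lemma Phi_zs : Phi zs = 0.
Proof.
have sub0 k (B : {set 'I_k}) (v : 'rV[R]_k) :
    (forall i, i \in B -> v 0 i = 0) -> subrow B v = 0.
  by move=> v0; apply/rowP => i; rewrite !mxE v0// enum_valP.
rewrite /Phi /hb /NL /= (sub0 _ I); last first.
  by move=> i; rewrite !inE => /andP[/eqP].
have -> : h zs = 0 by apply/rowP => j; rewrite mxE; case: zsF.
by rewrite (sub0 _ B1) ?(sub0 _ B2) ?row_mx0//; [exact: H_zs_B2|exact: G_zs_B1].
Qed.

Hypothesis crsc : CRSC NL zs.

(** [constant_rank_vanish] for [Phi], transported from neighbourhoods of [zs] to [U]; weights
    supported in [I] may be restricted to [I] without changing any product. *)
Lemma CRSC_vanish (mu : 'cV[R]_p) lam :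
  (forall i, i \notin I -> mu i 0 = 0) ->
  'J g zs *m mu + 'J hb zs *m lam = 0 ->
  forall e : R, 0 < e -> \forall y \near U,
    `|(g y *m mu) 0 0 + (hb y *m lam) 0 0| <= e * `|Phi y|.
Proof.
move=> muI E e e0.
have muI' i : i \notin I -> row i mu = 0.
  by move=> /muI mu0; apply/rowP => j; rewrite ord1 !mxE.
pose l := col_mx (rowsub (@ev p I) mu) lam.
have Dl : DPhi zs *m l = 0.
  by rewrite mul_row_col mul_colsub_rowsub// -jacobian_hb.
have rk : \forall y \near zs, \rank (DPhi y) = \rank (DPhi zs).
  by apply: filterS crsc => y; rewrite !rank_DPhi.
have := constant_rank_vanish has_grad_Phi near_continuous_DPhi rk Phi_zs Dl e0.
move=> /(near_filter_of_nbhs PU' (lim_near HL)); apply: filterS => y.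
rewrite mul_row_col subrow_colsub mul_colsub_rowsub// -add_mxE.
by [].
Qed.

(** On the active branch every equality constraint is, up to sign, an entry of the vector whose
    Euclidean norm is the residual. *)
Lemma hb_residual_le : \forall y \near U, `|hb y| <= residual2 P y.
Proof.
apply: filterS (lim_branch HL) => y by_.
have r0 := residual2_ge0 P y.
apply: norm_row_mx_le => //.
  by apply/mx_norm_leP => // i j; rewrite ord1; exact: residual2_h.
have GH i := residual2_GH P y i.
by apply: norm_row_mx_le => //; apply/mx_norm_leP => // i j; rewrite mxE;
  apply: le_trans (GH (enum_val j)); rewrite (active_branch_min _ by_);
  have := enum_valP j; rewrite ?in_B1 ?in_B2 => jb; rewrite ?jb ?(negbTE jb).
Qed.

(** Only a very negative [g_l] has to be excluded. In the relation certifying [l], the other [g_i]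
    are bounded above and the equalities in absolute value by the residual, so the small total keeps
    [g_l] from below. *)
Lemma Iminus_g_le l : l \in I -> exists2 K : R, 0 <= K &
  \forall y \near U, `|g y 0 l| <= 2^-1 * `|Phi y| + K * residual2 P y.
Proof.
move=> lI; have /nlp_IminusP[mu [lam [mu0 muA mul E]]] := lI.
have muI i : i \notin I -> mu i 0 = 0.
  apply: contraNeq => mui; apply/nlp_IminusP; exists mu, lam; split => //.
  by rewrite lt_neqAle eq_sym mui mu0.
have van := CRSC_vanish muI E.
have S0 : 0 <= \sum_i mu i 0 by apply: sumr_ge0 => i _; exact: mu0.
have L0 : 0 <= \sum_i `|lam i 0| by apply: sumr_ge0.
(* The summand 1 serves the upper bound on [g_l], the quotient the lower bound. *)
pose K := 1 + (\sum_i mu i 0 + \sum_i `|lam i 0|) / mu l 0.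
have K0 : 0 <= (\sum_i mu i 0 + \sum_i `|lam i 0|) / mu l 0.
  by rewrite divr_ge0 ?addr_ge0// ltW.
exists K; first by rewrite addr_ge0.
have e0 : 0 < mu l 0 / 2 by lra.
apply: filterS2 (van _ e0) hb_residual_le => y Hy hby.
have r0 := residual2_ge0 P y.
have gr i := residual_g_le P y i.
have P0 := normr_ge0 (Phi y).
rewrite ler_norml; apply/andP; split; last first.
  apply: le_trans (gr l) _.
  have : 0 <= (K - 1) * residual2 P y by rewrite mulr_ge0// /K addrC addKr.
  by have : 0 <= 2^-1 * `|Phi y| by []; lra.
have hl : `|(hb y *m lam) 0 0| <= residual2 P y * \sum_i `|lam i 0|.
  by rewrite (le_trans (ler_mulmx_norm _ _ _ _))// ler_wpM2r.
have gl : (g y *m mu) 0 0 <= mu l 0 * g y 0 l + residual2 P y * \sum_i mu i 0.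
  rewrite mxE (bigD1 l)//= mulrC lerD2l [in leRHS](bigD1 l)//= mulrDr.
  rewrite ler_wpDl ?mulr_ge0// mulr_sumr ler_sum// => i _.
  by rewrite ler_wpM2r.
rewrite -(@ler_pM2l _ (mu l 0))// mulrN mulrDr.
have -> : mu l 0 * (K * residual2 P y) = mu l 0 * residual2 P y +
    (\sum_i mu i 0 + \sum_i `|lam i 0|) * residual2 P y.
  by rewrite /K; field; rewrite gt_eqF.
move: Hy hl; rewrite !ler_norml => /andP[Hy _] /andP[_ hl].
have : 0 <= mu l 0 * residual2 P y by rewrite mulr_ge0.
by lra.
Qed.

Lemma Phi_residual_le : exists2 K : R, 0 < K &
  \forall y \near U, `|Phi y| <= K * residual2 P y.
Proof.
have /choice[K HK] : forall l : 'I_p, exists K : R, 0 <= K /\ (l \in I ->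
    \forall y \near U, `|g y 0 l| <= 2^-1 * `|Phi y| + K * residual2 P y).
  move=> l; have [lI|lI] := boolP (l \in I); last by exists 0.
  by have [K K0 ?] := Iminus_g_le lI; exists K.
have S0 : 0 <= \sum_l K l by apply: sumr_ge0 => l _; case: (HK l).
have near_all : \forall y \near U, forall l, l \in I ->
    `|g y 0 l| <= 2^-1 * `|Phi y| + K l * residual2 P y.
  apply: filter_forall => l; have [lI|lI] := boolP (l \in I).
    by case: (HK l) => _ /(_ lI); apply: filterS => y.
  by near=> y.
exists (2 * (1 + \sum_l K l)); first by lra.
apply: filterS2 near_all hb_residual_le => y Hg Hh.
have r0 := residual2_ge0 P y.
have P0 := normr_ge0 (Phi y).
have Sr0 : 0 <= (\sum_l K l) * residual2 P y by rewrite mulr_ge0.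
(* The half of [|Phi y|] on the right, due to the tolerance [mu l 0 / 2], is absorbed on the left;
   hence the factor 2 in the constant. *)
suff : `|Phi y| <= 2^-1 * `|Phi y| + (1 + \sum_l K l) * residual2 P y by lra.
have c0 : 0 <= 2^-1 * `|Phi y| + (1 + \sum_l K l) * residual2 P y by lra.
apply: norm_row_mx_le => //; last by lra.
apply/mx_norm_leP => // i j; rewrite ord1 mxE.
apply: le_trans (Hg _ (enum_valP j)) _; rewrite lerD2l ler_wpM2r//.
rewrite (bigD1 (enum_val j))//=.
have : 0 <= \sum_(i0 < p | i0 != enum_val j) K i0.
  by apply: sumr_ge0 => l _; case: (HK l).
by lra.
Unshelve. all: by end_near. Qed.

Let lb := col_mx lh (col_mx (rowsub (@ev m B1) lG) (rowsub (@ev m B2) lH)).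

Lemma row_lG_B1 i : i \notin B1 -> row i lG = 0.
Proof.
rewrite in_B1 => /(lim_G_eq0 HL) l0.
by apply/rowP => j; rewrite ord1 !mxE.
Qed.

Lemma row_lH_B2 i : i \notin B2 -> row i lH = 0.
Proof.
rewrite in_B2 negbK => /(lim_H_eq0 HL) l0.
by apply/rowP => j; rewrite ord1 !mxE.
Qed.

Lemma lim_stationary_branch : 'J g zs *m lg + 'J hb zs *m lb = 0.
Proof.
rewrite jacobian_hb !mul_row_col (mul_colsub_rowsub _ row_lG_B1).
by rewrite (mul_colsub_rowsub _ row_lH_B2) !addrA; exact/esym/(lim_stationary HL).
Qed.

Lemma hb_lb y : (hb y *m lb) 0 0 =
  (h y *m lh) 0 0 + (G y *m lG) 0 0 + (H y *m lH) 0 0.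
Proof.
rewrite /hb /NL /= !mul_row_col !subrow_colsub (mul_colsub_rowsub _ row_lG_B1).
by rewrite (mul_colsub_rowsub _ row_lH_B2) !addrA !add_mxE.
Qed.

(** The limiting stationarity relation is itself a certificate: it has nonnegative weights and
    places every index with positive [lg] in [I]. *)
Lemma lim_g_support i : i \notin I -> lg i 0 = 0.
Proof.
apply: contraNeq => lgi; apply/nlp_IminusP; exists lg, lb; split.
- by move=> j; exact: (lim_g_ge0 HL).
- by move=> j; exact: (lim_g_inactive P_C1 zsF HL).
- by rewrite lt_neqAle eq_sym lgi (lim_g_ge0 HL).
- exact: lim_stationary_branch.
Qed.

Lemma CRSC_contra : False.
Proof.
have [K K0 HK] := Phi_residual_le.
pose w y : R := ((g y *m lg) 0 0 + (hb y *m lb) 0 0) / residual2 P y.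
have w0 (e : R) : 0 < e -> \forall y \near U, `|w y| <= e.
  move=> e0; have eK0 : 0 < e / K by rewrite divr_gt0.
  have van := CRSC_vanish lim_g_support lim_stationary_branch eK0.
  near=> y; have r0 : 0 < residual2 P y by near: y; exact: (lim_pos HL).
  rewrite /w normrM normfV (gtr0_norm r0) ler_pdivrMr//.
  apply: (@le_trans _ _ (e / K * `|Phi y|)); first by near: y.
  apply: (@le_trans _ _ (e / K * (K * residual2 P y))).
    by rewrite ler_wpM2l ?(ltW eK0)//; near: y.
  by rewrite mulrA divfK ?gt_eqF.
(* Where [lg] is nonzero [g_i] is positive along [U] and equals its positive part; off the branch
   the limits of the G and H multipliers vanish. So truncation and selection do not alter the
   products. *)
have wE : \forall y \near U, w y = \sum_i lg i 0 * mult_g P y i 0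
    + \sum_i lh i 0 * mult_h P y i 0 + \sum_i lG i 0 * mult_G P b y i 0
    + \sum_i lH i 0 * mult_H P b y i 0.
  apply: filterS (lim_mult_sign HL) => y [sg _ _ _].
  rewrite /w hb_lb !addrA !mulrDl; congr (_ + _ + _ + _);
    rewrite mxE mulr_suml; apply: eq_bigr => i _; rewrite mxE.
  - have [->|l0] := eqVneq (lg i 0) 0; first by rewrite mulr0 !mul0r.
    have lg0 : 0 < lg i 0 by rewrite lt_neqAle eq_sym l0 (lim_g_ge0 HL).
    have := sg i l0; rewrite pmulr_rgt0//.
    by move=> g0; rewrite max_r ?(ltW g0)// mulrA (mulrC (g y 0 i)).
  - by rewrite mulrA (mulrC (h y 0 i)).
  - case: ifP => [_|/negbT ib]; first by rewrite mulrA (mulrC (G y 0 i)).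
    by rewrite (lim_G_eq0 HL ib) mulr0 !mul0r.
  - case: ifP => [ib|_]; last by rewrite mulrA (mulrC (H y 0 i)).
    by rewrite (lim_H_eq0 HL ib) mulr0 !mul0r.
have cvg1 : (\sum_i lg i 0 * mult_g P y i 0
    + \sum_i lh i 0 * mult_h P y i 0 + \sum_i lG i 0 * mult_G P b y i 0
    + \sum_i lH i 0 * mult_H P b y i 0) @[y --> U] --> (1 : R).
  rewrite -(lim_unit HL).
  by apply: cvgD; [apply: cvgD; [apply: cvgD|]|]; apply: cvg_sumr => i;
    rewrite expr2; apply: cvgM; first [exact: cvg_cst | exact: (lim_g HL)
      | exact: (lim_h HL) | exact: (lim_G HL) | exact: (lim_H HL)].
suff : (1 : R) = 0 by apply/eqP; rewrite oner_eq0.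
apply: (cvg_small_eq0 PU' cvg1) => e e0.
by apply: filterS2 wE (w0 e e0) => y <-.
Unshelve. all: by end_near. Qed.

End PiecewiseCRSC.

(** * Change of norm and exact penalty *)

Section NormEquivalence.
Variables (R : realType) (n : nat) (N : 'rV[R]_n -> R) (HN : is_norm N).

Lemma is_norm_sum (I : Type) (r : seq I) (x : I -> 'rV[R]_n) :
  N (\sum_(i <- r) x i) <= \sum_(i <- r) N (x i).
Proof.
elim: r => [|i r IH]; first by rewrite !big_nil (is_norm0 HN).
by rewrite !big_cons (le_trans (norm_triangle HN _ _))// lerD2l.
Qed.

Lemma is_norm_le_mx_norm : exists2 C : R, 0 < C & forall x, N x <= C * `|x|.
Proof.
pose S := \sum_(i < n) N (delta_mx 0 i).
have S0 : 0 <= S by apply: sumr_ge0 => i _; exact: is_norm_ge0.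
(* The summand 1 keeps the constant positive in dimension 0. *)
exists (1 + S) => [|x]; first by lra.
have xS : N x <= S * `|x|.
  rewrite [x in N x]row_sum_delta (le_trans (is_norm_sum _ _))// mulr_suml.
  apply: ler_sum => i _; rewrite (norm_scale HN) mulrC ler_wpM2l//.
    exact: is_norm_ge0.
  exact: ler_coord_norm.
by have := normr_ge0 x; lra.
Qed.

Lemma is_norm_distB x y : `|N x - N y| <= N (x - y).
Proof.
have H1 := norm_triangle HN (x - y) y; have H2 := norm_triangle HN (y - x) x.
rewrite !subrK in H1 H2; have H3 := is_normN HN (x - y); rewrite opprB in H3.
by rewrite ler_norml; apply/andP; split; lra.
Qed.

Lemma mx_norm_le_is_norm : exists2 c : R, 0 < c & forall x, c * `|x| <= N x.
Proof.
(* Without unit vectors the space is trivial; otherwise the constant is the minimum of [N] over the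
   compact unit sphere. *)
have [[x1 x11]|no1] := pselect (exists x : 'rV[R]_n, `|x| = 1); last first.
  exists 1 => // x; have [->|x0] := eqVneq x 0.
    by rewrite normr0 mulr0 (is_norm0 HN).
  exfalso; apply: no1; exists (`|x|^-1 *: x).
  by rewrite normrZ normfV normr_id mulVf// normr_eq0.
have [C C0 HC] := is_norm_le_mx_norm.
pose K := [set x : 'rV[R]_n | `|x - 0| <= 1] `&`
  [set x : 'rV[R]_n | 1 <= `|x - 0|].
have Kc : compact K.
  apply: compact_closedI; first exact: closed_ball_rV_compact.
  apply: (@preimage_closed _ _ (fun x : 'rV[R]_n => `|x - 0|)
    [set t : R | 1 <= t]).
    by move=> x _; exact: continuousB_norm.
  exact: closed_ge.
have [||x0 + x0min] := @EVT_min_rV R n N K _ Kc.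
- by exists x1; rewrite /K /= subr0 x11.
- apply: within_continuous_norm => x _ e e0; exists (e / C); first exact: divr_gt0.
  move=> y _ yx; rewrite (le_trans (is_norm_distB _ _))// (le_trans (HC _))//.
  by rewrite mulrC -ler_pdivlMr// ltW.
rewrite inE /K /= subr0 => -[x0le x0ge].
exists (N x0) => [|x].
  rewrite lt_neqAle is_norm_ge0// andbT eq_sym; apply/eqP => /(norm_eq0 HN) E.
  by move: x0ge; rewrite E normr0 ler10.
have [->|xn0] := eqVneq x 0; first by rewrite normr0 mulr0 (is_norm0 HN).
have nx0 : 0 < `|x| by rewrite normr_gt0.
have := x0min (`|x|^-1 *: x); rewrite inE /K /= subr0 normrZ normfV normr_id.
rewrite mulVf ?gt_eqF// => /(_ (conj (lexx _) (lexx _))).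
by rewrite (norm_scale HN) normfV normr_id mulrC ler_pdivlMr.
Qed.

End NormEquivalence.

(** * Existence of the error bound and exact penalisation *)

Section ErrorBound.
Variables (R : realType) (n p q m : nat) (P : mpsc R n p q m).

Lemma residual_feasible z : feasible P z -> residual P z = 0.
Proof.
move=> [g0 h0 GH0]; rewrite /residual !big1 ?addr0// => i _.
- have /eqP := GH0 i; rewrite mulf_eq0 => /orP[] /eqP ->.
    by rewrite normr0 min_l.
  by rewrite normr0 min_r.
- by rewrite h0 normr0.
- by rewrite max_l.
Qed.

Lemma sup_error_bound zs : mpsc_C1 P -> feasible P zs ->
  directional_quasi_normality P zs \/ piecewise_CRSC P zs ->
  exists alpha : R, error_bound P (fun x => `|x|) zs alpha.
Proof.
move=> P_C1 zsF cq; apply: contrapT => noEB.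
have [|U [b [lg [lh [lG [lH [d HL]]]]]]] := limit_multipliers_exist P_C1 zsF.
  by move=> alpha a0 ab; apply: noEB; exists alpha.
case: cq => [qn|pw]; first exact: (quasi_normality_contra P_C1 zsF HL qn).
apply: (CRSC_contra P_C1 zsF HL); apply: pw.
  rewrite -setI_eq0; apply/eqP/setP => i; rewrite !inE.
  by case: (i \in b); rewrite ?andbF.
by rewrite finset.setID.
Qed.

(** [N] is at most [C] times the sup norm; near-minimisers carry this over to distances. *)
Lemma error_bound_change_norm (N : 'rV[R]_n -> R) zs alpha : is_norm N ->
  feasible P zs -> error_bound P (fun x => `|x|) zs alpha ->
  exists alpha' : R, error_bound P N zs alpha'.
Proof.
move=> HN zsF [a0 Ha]; have [C C0 HC] := is_norm_le_mx_norm HN.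
exists (C * alpha); split; first by rewrite mulr_gt0.
have F0 : feasible P !=set0 by exists zs.
apply: filterS Ha => z Ha; rewrite -mulrA.
apply: (@le_trans _ _ (C * dist (fun x : 'rV[R]_n => `|x|) (feasible P) z)).
  apply/ler_addgt0Pr => e e0; have eC0 : 0 < e / C by rewrite divr_gt0.
  have [y Fy yd] := dist_adherent (is_norm_mx_norm R n) z F0 eC0.
  rewrite (le_trans (dist_le HN z Fy))// (le_trans (HC _))//.
  have : C * `|z - y| <= C * (dist (fun x : 'rV[R]_n => `|x|) (feasible P) z + e / C).
    by rewrite ler_wpM2l ?(ltW C0)// ltW.
  by rewrite mulrDr (mulrC C (e / C)) divfK ?gt_eqF.
by rewrite ler_wpM2l// ltW.
Qed.

(** Clarke's exact penalisation: for a nearly closest feasible [y],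
    [f zs <= f y <= f z + Lf * N (z - y)], and the error bound controls [N (z - y)]. *)
Lemma exact_penalty (N : 'rV[R]_n -> R) zs Lf alpha : is_norm N ->
  local_minimizer (mpsc_f P) (feasible P) zs ->
  lipschitz_around N (mpsc_f P) zs Lf -> error_bound P N zs alpha ->
  local_minimizer (fun z => mpsc_f P z + Lf * alpha * residual P z) setT zs.
Proof.
move=> HN [zsF zmin] [V Vn Vlip] [a0 Ha]; split => //.
rewrite residual_feasible// mulr0 addr0.
have Vzs : V zs by exact: nbhs_singleton.
(* A negative Lipschitz constant forces [N (z - zs) = 0], hence [z = zs], for all [z] near [zs]. *)
have [Lf0|Lf0] := ltP Lf 0.
  near=> z => _; have Vz : V z by near: z; exact: Vn.
  have := Vlip _ _ Vz Vzs; have := is_norm_ge0 HN (z - zs).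
  have := normr_ge0 (mpsc_f P z - mpsc_f P zs) => H1 H2 H3.
  have : N (z - zs) = 0 by nra.
  move=> /(norm_eq0 HN)/subr0_eq ->.
  by rewrite residual_feasible// mulr0 addr0.
have [c c0 Hc] := mx_norm_le_is_norm HN.
have [C C0 HC] := is_norm_le_mx_norm HN.
have F0 : feasible P !=set0 by exists zs.
have /near_normP[r r0 Hr] : \forall y \near zs,
    V y /\ (feasible P y -> mpsc_f P zs <= mpsc_f P y).
  by near=> y; split; near: y.
(* With [N (z - zs)] and [e'] at most [c * r / 4], the triangle inequality gives
   [N (y - zs) < c * r], so [y] falls in the ball of radius [r] where local optimality and the
   Lipschitz bound apply. *)
have [s s0 Hs] : exists2 s : R, 0 < s & C * s <= c * r / 4.
  exists (c * r / 4 / C); first by rewrite !divr_gt0// mulr_gt0.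
  by rewrite mulrC divfK ?gt_eqF.
have near_s := near_norm_le zs s0.
near=> z => _; have Vz : V z by near: z; exact: Vn.
have zzs : N (z - zs) <= c * r / 4.
  by rewrite (le_trans (HC _))// (le_trans _ Hs)// ler_wpM2l ?(ltW C0)//.
have Haz : dist N (feasible P) z <= alpha * residual P z by near: z.
apply/ler_addgt0Pr => e e0.
have cr0 : 0 < c * r by rewrite mulr_gt0.
(* The second bound makes [Lf * e' <= e]; the added 1 covers [Lf = 0]. *)
pose e' := Num.min (c * r / 4) (e / (Lf + 1)).
have e'0 : 0 < e' by rewrite lt_min !divr_gt0//; lra.
have [y Fy yd] := dist_adherent HN z F0 e'0.
have e'1 : e' <= c * r / 4 by rewrite ge_min lexx.
have e'2 : Lf * e' <= e.
  have : (Lf + 1) * e' <= e by rewrite mulrC -ler_pdivlMr ?ge_min ?lexx ?orbT//; lra.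
  by lra.
have zd := dist_le HN z zsF.
have yzs : `|y - zs| < r.
  rewrite -(@ltr_pM2l _ c)// (le_lt_trans (Hc _))//.
  have := norm_triangle HN (y - z) (z - zs); rewrite addrA subrK.
  by have := is_normN HN (z - y); rewrite opprB => ->; lra.
have [Vy /(_ Fy) fy] := Hr _ yzs.
have := Vlip _ _ Vz Vy; rewrite ler_norml => /andP[H1 _].
have H2 : Lf * N (z - y) <= Lf * (alpha * residual P z + e').
  by rewrite ler_wpM2l//; lra.
by rewrite -mulrA; lra.
Unshelve. all: by end_near. Qed.

End ErrorBound.

Theorem theorem5p3 (R : realType) (n p q m : nat) (P : mpsc R n p q m)
    (N : 'rV[R]_n -> R) (zs : 'rV[R]_n)
    (N_norm : is_norm N) (P_C1 : mpsc_C1 P)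
    (zs_opt : local_minimizer (mpsc_f P) (feasible P) zs)
    (zs_cq : directional_quasi_normality P zs \/ piecewise_CRSC P zs) :
  (exists alpha : R, error_bound P N zs alpha) /\
  (forall Lf alpha : R,
     lipschitz_around N (mpsc_f P) zs Lf ->
     error_bound P N zs alpha ->
     local_minimizer (fun z => mpsc_f P z + Lf * alpha * residual P z)
       setT zs).
Proof.
have zsF : feasible P zs by case: zs_opt.
split; last by move=> Lf alpha; exact: exact_penalty.
have [alpha] := sup_error_bound P_C1 zsF zs_cq.
exact: error_bound_change_norm.
Qed.
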